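(* Let $d\in\mathbb{N}$ and let $M$ be an Orlicz function such that the Orlicz space $L_M$ on $(0,1)$ is separable. There is a constant $c_d$ depending only on $d$ such that for every $f\in L_M(\mathbb{T}^d)$ and every $n\in\mathbb{N}$ there exist an integer $m(n)\le c_dn$ and cubes $(\Pi_k)_{k=1}^{m(n)}$ in $\mathbb{T}^d$ such that (i) each point of $\mathbb{T}^d$ belongs to at least one $\Pi_k$, $1\le k\le m(n)$; (ii) each point of $\mathbb{T}^d$ belongs to at most $c_d$ of the $\Pi_k$, $1\le k\le m(n)$; (iii) $J_f^M(\Pi_k)=\frac1n\|f\|_{L_M}$ for every $1\le k\le m(n)$.
   Context: An Orlicz function is an even convex function $M$ on $\mathbb{R}$ with $M(0)=0$; $L_M$ is the associated Orlicz space with norm $\|g\|_{L_M}=\inf\{\lambda>0:\int M(|g|/\lambda)\le1\}$. $\mathbb{T}^d$ is regarded as the product of $d$ circles and is equipped with the normalised Haar measure $m$; a cube in $\mathbb{T}^d$ is a Cartesian product of $d$ arcs of equal length. For a measurable $A\subset\mathbb{T}^d$ with $m(A)>0$, $\mu(f|_A)$ denotes the decreasing rearrangement of $|f|$ restricted to $A$ (a function on $(0,m(A))$, extended by $0$), the dilation is $(\sigma_u g)(t)=g(t/u)$, and $$J_f^M(A)=m(A)\,\big\|\sigma_{1/m(A)}\mu(f|_A)\big\|_{L_M(0,1)}.$$ Also $\|f\|_{L_M}=\|\mu(f)\|_{L_M(0,1)}$. *)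

(* Defs.v *)
From HB Require Import structures.
From mathcomp Require Import all_boot all_order all_algebra.
From mathcomp Require Import all_classical all_reals all_analysis.
Set Implicit Arguments. Unset Strict Implicit. Unset Printing Implicit Defensive.
Import Order.TTheory GRing.Theory Num.Theory.
Import numFieldNormedType.Exports.
Local Open Scope classical_set_scope.
Local Open Scope ring_scope.

(* Points of T^d are represented by d-tuples of
   reals with coordinates in [0,1) (the fundamental domain). *)

Section OrliczDefs.
Variable R : realType.

Definition unit_open : set R := `]0%R, 1%R[.

Definition orlicz_fun (M : R -> R) : Prop :=
  [/\ (forall x, M (- x) = M x),
      (forall x y t, 0 <= t <= 1 ->
         M (t * x + (1 - t) * y) <= t * M x + (1 - t) * M y)
    & M 0 = 0].

(* Luxemburg norm  inf { l > 0 : \int_D M(|g|/l) dmu <= 1 }  (+oo if empty) *)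
Definition orlicz_norm {dT} {T : measurableType dT}
  (mu : {measure set T -> \bar R}) (D : set T) (M : R -> R) (g : T -> R)
  : \bar R :=
  ereal_inf [set l%:E | l in [set l : R | 0 < l /\
     (\int[mu]_(x in D) (M (`|g x| / l))%:E <= 1)%E]].

Definition orlicz_space {dT} {T : measurableType dT}
  (mu : {measure set T -> \bar R}) (D : set T) (M : R -> R) (g : T -> R)
  : Prop :=
  measurable_fun D g /\ (orlicz_norm mu D M g < +oo)%E.

Definition orlicz01_separable (M : R -> R) : Prop :=
  exists F : nat -> (R -> R),
    (forall k, orlicz_space lebesgue_measure unit_open M (F k)) /\
    forall g : R -> R, orlicz_space lebesgue_measure unit_open M g ->
      forall e : R, 0 < e -> exists k,
        (orlicz_norm lebesgue_measure unit_open M (fun x : R => (g x - F k x)%R) < e%:E)%E.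

(* decreasing rearrangement of |f| restricted to A:
   mu(f|_A)(t) = inf { s >= 0 : m(A /\ {|f| > s}) <= t }.
   It vanishes for t >= m(A) (extension by 0). *)
Definition drearr {dT} {T : measurableType dT}
  (mu : {measure set T -> \bar R}) (A : set T) (f : T -> R) (t : R) : R :=
  fine (ereal_inf [set s%:E | s in [set s : R | 0 <= s /\
     (mu (A `&` [set x | (s < `|f x|)%R]) <= t%:E)%E]]).

Definition dilation (u : R) (g : R -> R) : R -> R := fun t => g (t / u).

Definition JfM {dT} {T : measurableType dT}
  (mu : {measure set T -> \bar R}) (M : R -> R) (f : T -> R) (A : set T)
  : \bar R :=
  ((fine (mu A))%:E *
   orlicz_norm lebesgue_measure unit_open M
     (dilation (fine (mu A))^-1 (drearr mu A f)))%E.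

Definition torus (d : nat) : set (d.-tuple R) :=
  [set t | forall i, 0 <= tnth t i < 1].

(* m is the normalised Haar measure of T^d (transported to [0,1)^d):
   it vanishes outside [0,1)^d and gives boxes their volume.  These two
   properties determine m uniquely on the (product Borel) sigma-algebra. *)
Definition haar_torus (d : nat) (m : {measure set (d.-tuple R) -> \bar R})
  : Prop :=
  m (~` @torus d) = 0%E /\
  forall a b : d.-tuple R, (forall i, 0 <= tnth a i <= tnth b i /\ tnth b i <= 1) ->
    m [set t | forall i, tnth a i <= tnth t i < tnth b i] =
    (\prod_(i < d) (tnth b i - tnth a i))%:E.

(* closed arc of T = R/Z starting at a with length l (points in [0,1)) *)
Definition arc (a l : R) : set R :=
  [set x | 0 <= x < 1 /\ exists k : int, a <= x + k%:~R <= a + l].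

Definition is_cube (d : nat) (Q : set (d.-tuple R)) : Prop :=
  exists (a : d.-tuple R) (l : R), 0 < l <= 1 /\
    Q = [set t | forall i, arc (tnth a i) l (tnth t i)].

End OrliczDefs.

Arguments torus {R} d.

(* Main.v *)
(* By equimeasurability, [J_f^M(A) = N] as soon as the integral over [A] of
   [M (m(A) |f| / N)] equals [m(A)]. Separability of [L_M(0,1)] makes every modular
   of [f] finite, so for a cube centred at [x] the two sides of this equation
   depend continuously on the radius; the left one is smaller for small radii and
   larger for the whole torus when [N = ||f|| / n]. Each [x] is thus the centre of a
   cube [Q_x] with [J_f^M(Q_x) = N].
   A greedy (Besicovitch) selection, always taking an uncovered centre of almost
   maximal radius, covers every point at most [4 ^ d] times. By convexity each
   selected cube has integral of [1 + M (|f| / (2 ||f||))] at least [1 / (2 n)], while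
   the integral over the torus is at most [2]; hence the selection stops, having
   covered the torus, after at most [4 * 4 ^ d * n] steps. *)
Require Import Defs.
From HB Require Import structures.
From mathcomp Require Import all_boot all_order all_algebra.
From mathcomp Require Import all_classical all_reals all_analysis.
From mathcomp Require Import measurable_realfun ring lra zify.
Import Order.TTheory GRing.Theory Num.Theory.
Import numFieldNormedType.Exports.
Local Open Scope classical_set_scope.
Local Open Scope ring_scope.

(** * Orlicz functions and Luxemburg norms *)

(** The balance equation uses the modular of [f] at the parameter [||f|| / n], whereas the norm only
    bounds modulars at parameters above [||f||]. Without finiteness at every parameter, dominated
    convergence would have no majorant and the continuity in the radius could fail. The weight
    [1 + M (|f| / (2 ||f||))] handles two kinds of cubes at once: those of measure at least
    [1 / (2 n)] are charged to the constant 1, and for the others convexity gains a factor that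
    makes up for their small measure. The 2 puts the parameter strictly above the norm, which is
    only an infimum. In [4 ^ d], one factor [2 ^ d] counts the signs of the displacements between a
    point and the centres of its cubes. The other is the price of a supremum of radii that need not
    be attained: radii within one sign class can differ by a factor up to 2. *)

Section OrliczFunction.
Context {R : realType} (M : R -> R) (oM : orlicz_fun M).

Lemma orlicz_fun0 : M 0 = 0.
Proof. by case: oM. Qed.

Lemma orlicz_fun_abs x : M `|x| = M x.
Proof. by case: oM => ev _ _; case: (ger0P x) => // _; rewrite ev. Qed.

Lemma orlicz_funZ_le t x : 0 <= t <= 1 -> M (t * x) <= t * M x.
Proof.
case: oM => _ /(_ x 0 t) cvx M0 /cvx.
by rewrite M0 !mulr0 !addr0.
Qed.

(** Convexity at 0, the midpoint of [x] and [- x], where evenness makes the two values equal. *)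
Lemma orlicz_fun_ge0 x : 0 <= M x.
Proof.
case: oM => ev cvx M0; have := cvx x (- x) (2^-1); rewrite ev.
have -> : 2^-1 * x + (1 - 2^-1) * - x = 0 by field.
rewrite M0 => h; suff : 0 <= 2^-1 * M x + (1 - 2^-1) * M x by lra.
by apply: h; lra.
Qed.

Lemma orlicz_funZ_ge t x : 1 <= t -> t * M x <= M (t * x).
Proof.
move=> t1; have t0 : 0 < t by rewrite (lt_le_trans _ t1).
rewrite -ler_pdivlMl//.
have {1}-> : x = t^-1 * (t * x) by rewrite mulrA mulVf ?mul1r// gt_eqF.
by apply: orlicz_funZ_le; rewrite invr_ge0 ltW//= invf_le1.
Qed.

Lemma orlicz_fun_nd x y : 0 <= x -> x <= y -> M x <= M y.
Proof.
move=> x0 xy; have [y0|y0] := eqVneq y 0.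
  have -> : x = y by apply/eqP; rewrite eq_le xy y0.
  by [].
have y1 : 0 < y by rewrite lt_neqAle eq_sym y0 (le_trans x0).
have -> : x = (x / y) * y by rewrite divfK.
have xy1 : 0 <= x / y <= 1.
  by rewrite divr_ge0 ?(ltW y1)//= ler_pdivrMr// mul1r.
apply: (le_trans (orlicz_funZ_le _ _ xy1)).
by rewrite ler_piMl ?orlicz_fun_ge0//; case/andP: xy1.
Qed.

(** [y] is a convex combination of [x] and [B + 1]. The extra 1 keeps this chord at least 1 long, so
    the weight [t] of its right end is at most [y - x]. *)
Lemma orlicz_fun_lip B x y : 0 <= x -> x <= y -> y <= B ->
  M y - M x <= (y - x) * M (B + 1).
Proof.
move=> x0 xy yB; have p : 0 < B + 1 - x by lra.
pose t := (y - x) / (B + 1 - x).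
have t0 : 0 <= t by rewrite divr_ge0; lra.
have t1 : t <= y - x.
  by rewrite /t ler_pdivrMr// ler_peMr; lra.
have t2 : t <= 1 by rewrite /t ler_pdivrMr//; lra.
have ye : y = t * (B + 1) + (1 - t) * x.
  by rewrite /t; field; lra.
have : M y <= t * M (B + 1) + (1 - t) * M x.
  by rewrite {1}ye; case: oM => _ cvx _; apply: cvx; rewrite t0 t2.
have := orlicz_fun_ge0 (B + 1); have := orlicz_fun_ge0 x.
nra.
Qed.

Lemma orlicz_fun_continuous : continuous M.
Proof.
move=> x; apply/cvgrPdist_le => /= e e0.
pose B := `|x| + 1.
have MB := orlicz_fun_ge0 (B + 1).
have de0 : 0 < e / (M (B + 1) + 1) by rewrite divr_gt0//; lra.
near=> y.
have yx1 : `|x - y| <= 1.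
  by near: y; apply: cvgr_dist_le => //; exact: cvg_id.
have yx2 : `|x - y| <= e / (M (B + 1) + 1).
  by near: y; apply: cvgr_dist_le => //; exact: cvg_id.
have yB : `|y| <= B.
  rewrite /B -lerBlDl (le_trans (lerB_dist _ _))// distrC//.
have xB : `|x| <= B by rewrite /B; lra.
have d2 : `| `|x| - `|y| | <= `|x - y| by exact: ler_dist_dist.
have key : `|M x - M y| <= `| `|x| - `|y| | * M (B + 1).
  rewrite -(orlicz_fun_abs x) -(orlicz_fun_abs y).
  have [xy|/ltW yx] := leP `|x| `|y|.
    rewrite ler0_norm; last by rewrite subr_le0 orlicz_fun_nd.
    rewrite (ler0_norm (_ : `|x| - `|y| <= 0)); last by lra.
    by rewrite !opprB orlicz_fun_lip.
  rewrite ger0_norm; last by rewrite subr_ge0 orlicz_fun_nd.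
  rewrite (ger0_norm (_ : 0 <= `|x| - `|y|)); last by lra.
  by rewrite orlicz_fun_lip.
apply: (le_trans key).
have : `|x - y| * (M (B + 1) + 1) <= e by rewrite -ler_pdivlMr//; lra.
have := normr_ge0 (x - y); have := normr_ge0 (`|x| - `|y|); nra.
Unshelve. all: by end_near. Qed.

Lemma orlicz_fun_measurable : measurable_fun setT M.
Proof. by apply: continuous_measurable_fun; exact: orlicz_fun_continuous. Qed.

End OrliczFunction.

Section OrliczNorm.
Context {R : realType} (M : R -> R) (oM : orlicz_fun M).
Context {d} {T : measurableType d} (mu : {measure set T -> \bar R}).
Implicit Types (D : set T) (g : T -> R).

Lemma measurable_orlicz_comp D g : measurable_fun D g ->
  measurable_fun D (fun x => (M (g x))%:E).
Proof.
move=> mg; apply/measurable_EFinP.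
exact: (measurableT_comp (orlicz_fun_measurable M oM) mg).
Qed.

Lemma measurable_orlicz_modular D g (l : R) : measurable_fun D g ->
  measurable_fun D (fun x => (M (`|g x| / l))%:E).
Proof.
move=> mg; apply: measurable_orlicz_comp; apply: measurable_funM => //.
exact: (measurableT_comp (@normr_measurable R setT) mg).
Qed.

Lemma orlicz_norm_le D g (l : R) : 0 < l ->
  (\int[mu]_(x in D) (M (`|g x| / l))%:E <= 1)%E ->
  (orlicz_norm mu D M g <= l%:E)%E.
Proof. by move=> l0 h; apply: ereal_inf_lbound; exists l. Qed.

Lemma orlicz_norm_lt D g c : (orlicz_norm mu D M g < c)%E ->
  exists l : R, [/\ 0 < l, (l%:E < c)%E &
    (\int[mu]_(x in D) (M (`|g x| / l))%:E <= 1)%E].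
Proof.
by move=> /ereal_inf_lt[_ [l [l0 h] <-] lc]; exists l.
Qed.

Lemma orlicz_norm_ge0 D g : (0 <= orlicz_norm mu D M g)%E.
Proof.
by apply: le_ereal_inf_tmp => _ [l [l0 _] <-]; rewrite lee_fin ltW.
Qed.

End OrliczNorm.

(** * Equimeasurability and decreasing rearrangements *)

(** Both sides are integrals of [phi] against push-forward measures on the open half-line, and these
    agree because they agree on rays. The condition [phi 0 = 0] removes the zero sets of [f] and
    [g], whose measures the hypothesis on levels does not relate. *)
Lemma equimeasurable_integral (R : realType) d1 d2 (X : measurableType d1)
    (Y : measurableType d2) (mu : {measure set X -> \bar R})
    (nu : {measure set Y -> \bar R}) (A : set X) (B : set Y)
    (f : X -> R) (g : Y -> R) (c : {nonneg R}) (phi : R -> \bar R) :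
  measurable A -> measurable B -> measurable_fun A f -> measurable_fun B g ->
  (mu A < +oo)%E -> (forall x, A x -> 0 <= f x) -> (forall y, B y -> 0 <= g y) ->
  (forall s : R, 0 <= s -> mu (A `&` [set x | s < f x]) =
     (c%:num%:E * nu (B `&` [set y | (s < g y)%R]))%E) ->
  measurable_fun setT phi -> (forall r, (0 <= phi r)%E) -> phi 0 = 0%E ->
  (\int[mu]_(x in A) phi (f x) = c%:num%:E * \int[nu]_(y in B) phi (g y))%E.
Proof.
move=> mA mB mf mg fin f0 g0 eqm mphi phi0 phi00.
have mfA : measurable_fun [set: X] (f \_ A).
  exact: (measurable_restrictT _ _).1.
have mgB : measurable_fun [set: Y] (g \_ B).
  exact: (measurable_restrictT _ _).1.
pose D : set R := `]0, +oo[%classic.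
have mD : measurable D by exact: measurable_itv.
have mphiD : measurable_fun D phi by exact: measurable_funTS.
have preim d (Z : measurableType d) (k : Z -> R) (C : set Z) (s : R) : 0 <= s ->
    (k \_ C) @^-1` `]s, +oo[%classic = C `&` [set x | s < k x].
  move=> s0; apply/seteqP; split => x /=; rewrite patchE in_itv/= andbT.
    by case: ifPn => [/set_mem//|_ /(le_lt_trans s0)]; rewrite ltxx.
  by case=> Cx; rewrite (mem_set Cx).
have push d (Z : measurableType d) (rho : {measure set Z -> \bar R}) (C : set Z)
    (k : Z -> R) (mC : measurable C) (mk : measurable_fun [set: Z] (k \_ C)) :
    (forall x, C x -> 0 <= k x) ->
    (\int[rho]_(x in C) phi (k x) = \int[pushforward rho (k \_ C)]_(r in D) phi r)%E.
  move=> k0; rewrite [RHS]ge0_integral_pushforward//.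
  rewrite /D preim// [RHS]integral_mkcond integral_mkcond.
  apply: eq_integral => x _; rewrite !patchE/= patchE.
  case: ifPn => /= [xC|xC]; last by rewrite memNset//= => -[/mem_set]; rewrite (negbTE xC).
  have Cx := set_mem xC.
  case: ifPn => //; rewrite notin_setE/= => h.
  have -> : k x = 0.
    apply/eqP; rewrite eq_le k0// andbT leNgt; apply/negP => kx.
    by apply: h; split.
  by rewrite phi00.
rewrite push// push// -ge0_integral_mscale//.
apply: eq_measure_integral => E mE ED.
pose m1 := mrestr (pushforward mu (f \_ A)) mD.
pose m2 := mrestr (mscale c (pushforward nu (g \_ B))) mD.
suff : m1 E = m2 mgB E by rewrite /m1 /m2 /mrestr /= setIidl.
(* Levels are compared for [s >= 0] only, so each ray is first cut down to the open half-line. *)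
have pre s : D `&` `]s, +oo[%classic = `](Num.max 0 s), +oo[%classic.
  apply/seteqP; split => x /=; rewrite /D/= !in_itv/= !andbT gt_max.
    by case=> -> ->.
  by case/andP.
apply: (measure_unique (@RGenOInfty.G R) (fun k => `](- k%:R), +oo[%classic)) => //.
- exact: RGenOInfty.measurableE.
- move=> _ _ [x ->] [y ->]; exists (Num.max x y).
  apply/seteqP; split => z /=; rewrite !in_itv/= !andbT gt_max.
    by case=> -> ->.
  by case/andP.
- by move=> i; exists (- i%:R).
- apply/seteqP; split => // x _; exists (Num.bound `|x|) => //=.
  rewrite in_itv/= andbT ltrNl (le_lt_trans (ler_norm _))// normrN.
  by rewrite archi_boundP.
- move=> _ [s ->].
  change (mu ((f \_ A) @^-1` (`]s, +oo[%classic `&` D)) =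
    (c%:num%:E * nu ((g \_ B) @^-1` (`]s, +oo[%classic `&` D)))%E).
  rewrite setIC pre.
  by rewrite !preim ?le_max ?lexx//; apply: eqm; rewrite le_max lexx.
- move=> k.
  change (mu ((f \_ A) @^-1` (`](- k%:R)%R, +oo[%classic `&` D)) < +oo)%E.
  rewrite setIC pre preim ?le_max ?lexx//.
  apply: le_lt_trans fin; apply: le_measure; rewrite ?inE//.
    rewrite -preim ?le_max ?lexx// -[X in measurable X]setTI.
    by apply: mfA => //; exact: measurable_itv.
Qed.

Section Rearrangement.
Context {R : realType} {d} {T : measurableType d}.
Context (mu : {measure set T -> \bar R}) (A : set T) (f : T -> R).
Context (mA : measurable A) (mf : measurable_fun A f) (fin : (mu A < +oo)%E).

Let E (s : R) : set T := A `&` [set x | s < `|f x|].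

Let mE s : measurable (E s).
Proof.
have -> : E s = A `&` (Num.norm \o f) @^-1` `]s, +oo[%classic.
  by apply/seteqP; split => x /=; rewrite in_itv/= andbT.
by apply: (measurableT_comp (@normr_measurable R setT) mf) => //; exact: measurable_itv.
Qed.

Let E_finite s : (mu (E s) < +oo)%E.
Proof.
by apply: le_lt_trans fin; apply: le_measure; rewrite ?inE//; exact: subIsetl.
Qed.

Let E_mono s t : s <= t -> (mu (E t) <= mu (E s))%E.
Proof.
move=> st; apply: le_measure; rewrite ?inE//.
by apply: setIS => x /=; exact: le_lt_trans.
Qed.

(** The level sets decrease to the empty set because [f] is real-valued. Hence for [t > 0] the
    infimum in [drearr] is finite and [fine] does not turn an infinite value into 0. *)
Let E_tail (t : R) : 0 < t -> exists2 s, 0 <= s & (mu (E s) <= t%:E)%E.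
Proof.
move=> t0.
have cv : mu (E n%:R) @[n --> \oo] --> mu (\bigcap_n E n%:R).
  apply: nonincreasing_cvg_mu; [exact: E_finite|by []| |].
    exact: bigcapT_measurable.
  move=> m n mn; apply/subsetPset; apply: setIS => x /=; apply: le_lt_trans.
  by rewrite ler_nat.
have e0 : \bigcap_n E n%:R = set0.
  rewrite -subset0 => x /(_ (Num.bound `|f x|) I)[_ /=].
  by apply/negP; rewrite -leNgt ltW// archi_boundP.
rewrite e0 measure0 in cv.
have [N _ /(_ N (leqnn _)) h] : \forall n \near \oo, (mu (E n%:R) < t%:E)%E.
  by apply: (cv _ (open_ereal_lt' _)); rewrite lte_fin.
by exists N%:R => //; exact: ltW.
Qed.

Let S t := [set s%:E | s in [set s : R | 0 <= s /\ (mu (E s) <= t%:E)%E]].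

Let S_ge0 t : (0 <= ereal_inf (S t))%E.
Proof. by apply: le_ereal_inf_tmp => _ [s [s0 _] <-]; rewrite lee_fin. Qed.

Lemma drearr_ge0 t : 0 <= drearr mu A f t.
Proof. exact/fine_ge0/S_ge0. Qed.

Let S_fin t : 0 < t -> ereal_inf (S t) \is a fin_num.
Proof.
move=> /E_tail[s s0 Es]; rewrite ge0_fin_numE//.
apply: (@le_lt_trans _ _ s%:E); last exact: ltry.
by apply: ereal_inf_lbound; exists s.
Qed.

(** The rearrangement is a generalised inverse of the distribution function; the strict form rests
    on the right-continuity of the latter. *)
Lemma drearr_gt (s t : R) : 0 <= s -> 0 < t ->
  (s < drearr mu A f t) = (t%:E < mu (A `&` [set x | (s < `|f x|)%R]))%E.
Proof.
move=> s0 t0; apply/idP/idP => [|tE].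
  apply: contraTT; rewrite -!leNgt => Et.
  rewrite /drearr -lee_fin fineK; last exact: S_fin.
  by apply: ereal_inf_lbound; exists s.
(* [E s] is the increasing union of these sets, so some level strictly above [s] still has measure
   above [t]. *)
pose F n := E (s + n.+1%:R^-1).
have cv : mu (F n) @[n --> \oo] --> mu (\bigcup_n F n).
  apply: nondecreasing_cvg_mu; [by move=> ?; exact: mE|by apply: bigcupT_measurable => ?; exact: mE|].
  move=> m n mn; apply/subsetPset; apply: setIS => x /=; apply: le_lt_trans.
  by rewrite lerD2l lef_pV2 ?posrE// ler_nat.
have eU : \bigcup_n F n = E s.
  apply/seteqP; split => x.
    by move=> [n _ [Ax /= h]]; split => //=; apply: lt_trans h; rewrite ltrDl.
  move=> [Ax /= h]; exists (Num.bound (`|f x| - s)^-1) => //; split => //=.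
  rewrite -ltrBrDl invf_plt ?posrE ?subr_gt0// (lt_trans (archi_boundP _))//.
    by rewrite invr_ge0 subr_ge0 ltW.
  by rewrite ltr_nat.
rewrite eU in cv.
have [N _ /(_ N (leqnn _)) h] : \forall n \near \oo, (t%:E < mu (F n))%E.
  exact: (cv _ (open_ereal_gt' tE)).
apply: (@lt_le_trans _ _ (s + N.+1%:R^-1)); first by rewrite ltrDl.
rewrite /drearr -lee_fin fineK; last exact: S_fin.
apply: le_ereal_inf_tmp => _ [r [r0 Er] <-]; rewrite lee_fin leNgt.
apply/negP => /ltW /E_mono; apply/negP; rewrite -ltNge.
exact: le_lt_trans Er h.
Qed.

Let v := fine (mu A).

Let muAE : mu A = v%:E.
Proof. by rewrite /v fineK// ge0_fin_numE. Qed.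

Let level s : exists2 w, 0 <= w <= v & mu (E s) = w%:E.
Proof.
exists (fine (mu (E s))); last by rewrite fineK// ge0_fin_numE.
rewrite fine_ge0//= fine_le ?ge0_fin_numE//.
by apply: le_measure; rewrite ?inE//; exact: subIsetl.
Qed.

Let dilation_level (s w : R) : 0 < v -> 0 <= s -> mu (E s) = w%:E -> w <= v ->
  @unit_open R `&` [set t | s < dilation v^-1 (drearr mu A f) t] =
  `]0, (w / v)[%classic.
Proof.
move=> v0 s0 Ew wv; apply/seteqP; split => t /=.
  rewrite /unit_open /= !in_itv/= /dilation invrK => -[/andP[t0 t1]].
  by rewrite drearr_gt ?mulr_gt0// -/(E s) Ew lte_fin t0/= ltr_pdivlMr.
rewrite /unit_open /= !in_itv/= /dilation invrK => /andP[t0 tw].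
rewrite drearr_gt ?mulr_gt0// -/(E s) Ew lte_fin t0/= -ltr_pdivlMr//; split => //.
by rewrite (lt_le_trans tw)// ler_pdivrMr// mul1r.
Qed.

Lemma measurable_dilation_drearr : (0 < mu A)%E ->
  measurable_fun (@unit_open R) (dilation (fine (mu A))^-1 (drearr mu A f)).
Proof.
rewrite -/v muAE lte_fin => v0.
have mU : measurable (@unit_open R) by exact: measurable_itv.
apply: (measurability (@RGenOInfty.G R)).
  exact: RGenOInfty.measurableE.
move=> _ [_ [s ->] <-]; set g := dilation _ _.
have -> : g @^-1` `]s, +oo[ = [set t | s < g t].
  by apply/seteqP; split => x /=; rewrite in_itv/= andbT.
have [s0|s0] := leP 0 s.
  have [w /andP[w0 wv] Ew] := level s.
  by rewrite (dilation_level _ w)//; exact: measurable_itv.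
rewrite (_ : _ `&` _ = @unit_open R)//; apply: setIidl => t _ /=.
by rewrite (lt_le_trans s0)// drearr_ge0.
Qed.

(** The dilation stretches (0, m(A)) onto (0, 1) and so divides the length of every level by m(A);
    the factor in front restores it. *)
Lemma drearr_equimeasurable (phi : R -> \bar R) :
  measurable_fun setT phi -> (forall r, (0 <= phi r)%E) -> phi 0 = 0%E ->
  (0 < mu A)%E ->
  (\int[mu]_(x in A) phi `|f x|%R = (fine (mu A))%:E *
    \int[lebesgue_measure]_(t in @unit_open R)
      phi `|dilation (fine (mu A))^-1 (drearr mu A f) t|%R)%E.
Proof.
move=> mphi phi0 phi00 A0; rewrite -/v.
have v0 : 0 < v by rewrite -lte_fin -muAE.
pose c : {nonneg R} := NngNum (ltW v0).
have mU : measurable (@unit_open R) by exact: measurable_itv.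
have mg := measurable_dilation_drearr A0.
have mnf : measurable_fun A (fun x => `|f x|).
  exact: (measurableT_comp (@normr_measurable R setT) mf).
rewrite (@equimeasurable_integral R _ _ T _ mu lebesgue_measure A
  (@unit_open R) _ _ c phi mA mU mnf mg fin)//.
- congr (_ * _)%E; apply: eq_integral => t _.
  by rewrite ger0_norm// drearr_ge0.
- by move=> y _; rewrite drearr_ge0.
- move=> s s0; have [w /andP[w0 wv] Ew] := level s.
  rewrite (dilation_level _ w)// -/(E s) Ew.
  have lm (u : R) : 0 <= u -> lebesgue_measure (`]0, u[%classic : set R) = u%:E.
    move=> u0; rewrite lebesgue_measure_itv/= lte_fin lt_neqAle u0 andbT eq_sym.
    by have [->|_] := eqVneq u 0 => //=; rewrite sube0.
  transitivity (v%:E * (w / v)%:E)%E.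
    by rewrite -EFinM mulrC divfK// gt_eqF.
  by congr (_ * _)%E; apply/esym/lm; rewrite divr_ge0// ltW.
Qed.

End Rearrangement.

(** * Separability and finiteness of modulars *)

(* The sequence [F] cannot be dense if the modular of [K g] is infinite: cut
   [g] into level blocks [B k] of modular at least 1, and keep or delete the
   [k]-th block of [g] so as to stay away from [F k] there. *)
Lemma separable_modular_finite (R : realType) d (T : measurableType d)
    (mu : {measure set T -> \bar R}) (D : set T) (M : R -> R) (F : nat -> T -> R)
    (g : T -> R) (K : R) :
  orlicz_fun M -> measurable D -> (mu D <= 1)%E ->
  (forall k, measurable_fun D (F k)) ->
  (forall h : T -> R, orlicz_space mu D M h -> forall e : R, 0 < e ->
     exists k, (orlicz_norm mu D M (fun x => (h x - F k x)%R) < e%:E)%E) ->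
  orlicz_space mu D M g -> 0 < K ->
  (\int[mu]_(x in D) (M (K * `|g x|))%:E < +oo)%E.
Proof.
move=> oM mD muD mF F_dense [mg g_norm] K0.
rewrite ltNge leye_eq; apply/negP => /eqP intgoo.
pose phi x := (M (K * `|g x|))%:E.
have phi0 x : (0 <= phi x)%E by rewrite lee_fin orlicz_fun_ge0.
have mnorm (h : T -> R) : measurable_fun D h -> measurable_fun D (fun x => `|h x|).
  by move=> mh; exact: (measurableT_comp (@normr_measurable R setT) mh).
have mphi : measurable_fun D phi.
  apply: measurable_orlicz_comp => //; apply: measurable_funM => //.
  exact: mnorm.
have measurable_level (i : interval R) : measurable (D `&` [set x | `|g x| \in i]).
  exact: (mnorm _ mg mD _ (measurable_itv i)).
pose G (b : nat) := D `&` [set x | `|g x| \in `]-oo, b%:R[].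
have mG b : measurable (G b) by exact: measurable_level.
have G_le (a : nat) : (\int[mu]_(x in G a) phi x <= (M (K * a%:R))%:E)%E.
  have Ga1 : (mu (G a) <= 1)%E.
    apply: le_trans muD; apply: le_measure; [exact/mem_set/mG|exact/mem_set|exact: subIsetl].
  apply: (@le_trans _ _ (\int[mu]_(x in G a) (M (K * a%:R))%:E)%E).
    apply: ge0_le_integral => //.
    - by apply: (measurable_funS mD _ mphi) => //; exact: subIsetl.
    - move=> x [_ /=]; rewrite in_itv/= => xa.
      rewrite lee_fin orlicz_fun_nd// ?mulr_ge0// ?(ltW K0)//.
      by rewrite ler_pM2l// ltW.
  rewrite integral_cst//= -[leRHS]mule1; apply: lee_pmul => //.
  by rewrite lee_fin orlicz_fun_ge0.
have G_cvg : (\int[mu]_(x in G b) phi x @[b --> \oo] --> +oo)%E.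
  rewrite -intgoo (_ : D = \bigcup_b G b); last first.
    apply/seteqP; split => [x Ux|x [n _ []//]].
    exists (Num.bound `|g x|) => //; split => //=.
    by rewrite in_itv/= archi_boundP.
  apply: ge0_nondecreasing_set_cvg_integral => //.
  - move=> m n mn; apply/subsetPset; apply: setIS => x /=; rewrite !in_itv/=.
    by move=> /lt_le_trans; apply; rewrite ler_nat.
  - by move=> b; apply: (measurable_funS mD _ mphi) => //; exact: subIsetl.
pose L (a b : nat) := D `&` [set x | `|g x| \in `[a%:R, b%:R[].
have mL a b : measurable (L a b) by exact: measurable_level.
(* The part below level [a] contributes at most [M (K * a)], so an infinite total leaves modular 1
   between [a] and some higher level. *)
have next (a : nat) : exists b, (a < b)%N /\ (1 <= \int[mu]_(x in L a b) phi x)%E.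
  have /cvgeyPge /(_ (M (K * a%:R) + 1)) [N _ GN] := G_cvg.
  pose b := maxn N a.+1.
  have ab : (a < b)%N by rewrite leq_max leqnn orbT.
  exists b; split => //.
  have /GN : (N <= b)%N by rewrite leq_maxl.
  have -> : G b = G a `|` L a b.
    apply/seteqP; split => x; rewrite /G /L /= !in_itv/=.
      by move=> [Ux xb]; case: (ltP `|g x| a%:R) => xa; [left|right].
    move=> [[Ux xa]|[Ux /andP[xa xb]]]; split => //.
    by rewrite (lt_trans xa)// ltr_nat.
  rewrite ge0_integral_setU//; last 2 first.
  - by apply: (measurable_funS mD _ mphi) => //; rewrite -setIUr; exact: subIsetl.
  - apply/disj_setPS => x [[_ /=]]; rewrite in_itv/= => xa [_ /=].
    by rewrite in_itv/= => /andP[/(lt_le_trans xa)]; rewrite ltxx.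
  rewrite EFinD => h; have fa := G_le a.
  have Lge : ((M (K * a%:R))%:E + 1 <= (M (K * a%:R))%:E + \int[mu]_(x in L a b) phi x)%E.
    by apply: (le_trans h); rewrite leeD2r.
  by move: Lge; rewrite leeD2lE.
have [nxt nxtP] := choice next.
pose a k := iter k nxt 0%N.
have a_nd : {homo a : m n / (m <= n)%N}.
  apply: homo_leq => //; first exact: leq_trans.
  by move=> k; exact: ltnW (nxtP (a k)).1.
pose B k := L (a k) (a k.+1).
have B_disj j k x : B j x -> B k x -> j = k.
  wlog jk : j k / (j < k)%N => [W Bj Bk|].
    by have [/W->|/W->|] := ltngtP j k.
  move=> [_ /=]; rewrite in_itv/= => /andP[_ xj] [_ /=]; rewrite in_itv/=.
  move=> /andP[xk _]; have := le_lt_trans xk xj.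
  by rewrite ltr_nat => lt; have := a_nd j.+1 k jk; rewrite leqNgt lt.
(* This radius fits the midpoint estimate at the end, which doubles [K]. *)
pose e := (2 * K)^-1.
have e0 : 0 < e by rewrite invr_gt0 mulr_gt0.
pose small (h : T -> R) k := (\int[mu]_(x in B k) (M (`|h x| / e))%:E < 1)%E.
(* Block [k] is kept exactly when [F k] is small on it. *)
pose S k := small (F k) k.
pose E := \bigcup_(k in S) B k.
have mE : measurable E by apply: bigcup_measurable => k _; exact: mL.
have BD k : B k `<=` D by exact: subIsetl.
have mB k : measurable (B k) by exact: mL.
have gE_space : orlicz_space mu D M (g \_ E).
  have mgE : measurable_fun D (g \_ E).
    apply: (measurable_restrict _ mE mD).1; apply: (measurable_funS mD _ mg) => //.
  split => //; have /orlicz_norm_lt[l [l0 _ gl]] := g_norm.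
  apply: (@le_lt_trans _ _ l%:E); last exact: ltry.
  apply: orlicz_norm_le => //; apply: le_trans gl.
  apply: ge0_le_integral => //.
  - by move=> x _; rewrite lee_fin orlicz_fun_ge0.
  - exact: measurable_orlicz_modular.
  - exact: measurable_orlicz_modular.
  - move=> x _; rewrite lee_fin orlicz_fun_nd//; first by rewrite divr_ge0// ltW.
    rewrite ler_pM2r ?invr_gt0// patchE; case: ifPn => // _.
    by rewrite normr0.
have [k] := F_dense _ gE_space e e0.
move=> /orlicz_norm_lt[l [l0]]; rewrite lte_fin => le gFl.
have mgF : measurable_fun D (fun x => (g \_ E) x - F k x).
  by apply: measurable_funB => //; case: gE_space.
have gF : small (fun x => (g \_ E) x - F k x) k.
  (* [small] is a strict inequality; passing from parameter [l] to the larger [e] gains the factor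
     [l / e < 1] by convexity. *)
  have r1 : l / e < 1 by rewrite ltr_pdivrMr// mul1r.
  have r0 : 0 <= l / e by rewrite divr_ge0// ltW.
  apply: (@le_lt_trans _ _ (l / e)%:E); last by rewrite lte_fin.
  apply: (@le_trans _ _ (\int[mu]_(x in D)
      ((l / e)%:E * (M (`|(g \_ E) x - F k x| / l))%:E))%E).
    apply: (@le_trans _ _ (\int[mu]_(x in D) (M (`|(g \_ E) x - F k x| / e))%:E)%E).
      apply: ge0_subset_integral => //.
        exact: measurable_orlicz_modular.
      by move=> x _; rewrite lee_fin orlicz_fun_ge0.
    apply: ge0_le_integral => //.
    - by move=> x _; rewrite lee_fin orlicz_fun_ge0.
    - exact: measurable_orlicz_modular.
    - by apply: measurable_funeM; exact: measurable_orlicz_modular.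
    - move=> x _; rewrite -EFinM lee_fin.
      have -> : `|(g \_ E) x - F k x| / e = (l / e) * (`|(g \_ E) x - F k x| / l).
        by field; rewrite !gt_eqF.
      by apply: orlicz_funZ_le; rewrite // r0 ltW.
  rewrite ge0_integralZl//.
  - by rewrite -[leRHS]mule1; apply: lee_pmul => //; apply: integral_ge0 => x _;
      rewrite lee_fin orlicz_fun_ge0.
  - exact: measurable_orlicz_modular.
  - by move=> x _; rewrite lee_fin orlicz_fun_ge0.
(* On a deleted block the difference is [- F k], whose smallness would put [k] into [S]. *)
have [Sk|nSk] := pselect (S k); last first.
  apply: (nSk); move: gF; rewrite /S /small; apply: le_lt_trans.
  rewrite le_eqVlt; apply/orP; left; apply/eqP; apply: eq_integral => x /set_mem Bx.
  rewrite patchE; case: ifPn => [/set_mem[j Sj Bj]|_]; last by rewrite sub0r normrN.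
  by case: (nSk); rewrite (B_disj k j x Bx Bj).
(* On a kept block, [K |g|] is at most the midpoint of [2 K |g - F k|] and [2 K |F k|], both of
   modular below 1; this contradicts the choice of the block. *)
have := (nxtP (a k)).2; rewrite -/(a k.+1) -/(L _ _) -/(B k) leNgt.
apply/negP; rewrite negbK.
pose h1 x := (M (`|(g \_ E) x - F k x| / e))%:E.
pose h2 x := (M (`|F k x| / e))%:E.
have mh1 : measurable_fun (B k) h1.
  by apply: measurable_orlicz_modular => //; apply: (measurable_funS mD _ mgF).
have mh2 : measurable_fun (B k) h2.
  by apply: measurable_orlicz_modular => //; apply: (measurable_funS mD _ (mF k)).
have h10 x : (0 <= h1 x)%E by rewrite lee_fin orlicz_fun_ge0.
have h20 x : (0 <= h2 x)%E by rewrite lee_fin orlicz_fun_ge0.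
apply: (@le_lt_trans _ _ (\int[mu]_(x in B k) ((2^-1)%:E * (h1 x + h2 x)))%E).
  apply: ge0_le_integral => //.
  - by apply: (measurable_funS mD _ mphi).
  - by apply: measurable_funeM; exact: emeasurable_funD.
  - move=> x Bx; rewrite /phi /h1 /h2 -EFinD -EFinM lee_fin.
    have -> : (g \_ E) x = g x by rewrite patchE mem_set//; exists k.
    have -> : 2^-1 * (M (`|g x - F k x| / e) + M (`|F k x| / e)) =
       2^-1 * M (`|g x - F k x| / e) + (1 - 2^-1) * M (`|F k x| / e) by field.
    apply: (@le_trans _ _ (M (2^-1 * (`|g x - F k x| / e) + (1 - 2^-1) * (`|F k x| / e)))).
      apply: orlicz_fun_nd => //; first by rewrite mulr_ge0// ltW.
      rewrite /e invrK.
      have -> : 2^-1 * (`|g x - F k x| * (2 * K)) + (1 - 2^-1) * (`|F k x| * (2 * K))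
         = K * (`|g x - F k x| + `|F k x|) by field.
      by rewrite ler_pM2l// -[X in `|X| <= _](subrK (F k x)) ler_normD.
    by case: oM => _ cvx _; apply: cvx; rewrite invr_ge0 ler0n/= invf_le1// ler1n.
rewrite ge0_integralZl//; last 2 first.
- exact: emeasurable_funD.
- by move=> x _; rewrite adde_ge0.
rewrite ge0_integralD//.
have i1 : (0 <= \int[mu]_(x in B k) h1 x)%E by apply: integral_ge0.
have i2 : (0 <= \int[mu]_(x in B k) h2 x)%E by apply: integral_ge0.
have f1 : (\int[mu]_(x in B k) h1 x)%E \is a fin_num.
  by rewrite ge0_fin_numE// (lt_trans gF)// ltry.
have f2 : (\int[mu]_(x in B k) h2 x)%E \is a fin_num.
  by rewrite ge0_fin_numE// (lt_trans Sk)// ltry.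
move: gF Sk; rewrite /S /small -/h1 -/h2.
rewrite -(fineK f1) -(fineK f2) -EFinD -EFinM !lte_fin; lra.
Qed.

(** * Greedy selection of cubes *)

Section Greedy.
Context {R : realType} {X : eqType} (T : set X) (Q : X -> set X) (rho : X -> R).

Definition covered (s : seq X) : set X := [set z | exists2 y, y \in s & Q y z].

(* The most recently chosen centre comes first. *)
Fixpoint greedy (s : seq X) : Prop :=
  if s is x :: s' then
    [/\ greedy s', T x, ~ covered s' x &
        forall z, T z -> ~ covered s' z -> rho z < 2 * rho x]
  else True.

(** Lists run from newest to oldest, so in a pairwise statement [x] is the centre chosen after
    [y]. *)
Definition greedy_rel : rel X := fun x y => `[< ~ Q y x /\ rho x < 2 * rho y >].

Lemma greedy_sub s : greedy s -> forall x, x \in s -> T x.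
Proof.
elim: s => // x s IH [gs Tx _ _] y; rewrite inE => /orP[/eqP->//|].
exact: IH.
Qed.

(** A point uncovered now was uncovered at every earlier choice, hence was a competitor each
    time. *)
Lemma greedy_lt s z : greedy s -> T z -> ~ covered s z ->
  forall y, y \in s -> rho z < 2 * rho y.
Proof.
elim: s => // x s IH [gs Tx nx max] Tz nz y.
have nz' : ~ covered s z by move=> [u us Qu]; apply: nz; exists u; rewrite ?inE ?us ?orbT.
rewrite inE => /orP[/eqP->|ys]; first exact: max.
exact: IH.
Qed.

Lemma greedy_pairwise s : greedy s -> pairwise greedy_rel s.
Proof.
elim: s => // x s IH /= [gs Tx nx _]; rewrite IH// andbT.
apply/allP => y ys; apply/asboolP; split.
  by move=> Qyx; apply: nx; exists y.
exact: greedy_lt gs Tx nx _ ys.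
Qed.

(** Any radius above half of the supremum will do; the supremum itself need not be attained. *)
Lemma near_maximizer (U : set X) (b : R) : U !=set0 ->
  (forall x, U x -> 0 < rho x <= b) ->
  exists2 x, U x & forall z, U z -> rho z < 2 * rho x.
Proof.
move=> [x0 Ux0] bnd; pose V := [set rho x | x in U].
have V0 : V !=set0 by exists (rho x0), x0.
have Vb : has_sup V.
  by split => //; exists b => _ [x Ux <-]; case/andP: (bnd _ Ux).
have Vub x : U x -> rho x <= sup V by move=> Ux; apply: sup_upper_bound => //; exists x.
have sV : 0 < sup V by case/andP: (bnd _ Ux0) => /lt_le_trans h _; apply: h; exact: Vub.
have [_ [x Ux <-] h] : exists2 r, V r & sup V - sup V / 2 < r.
  by apply: sup_adherent; rewrite ?divr_gt0.
by exists x => // z /Vub; lra.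
Qed.

(** Termination is left open here: taking [N] above an a priori bound on the size of greedy lists
    excludes the first alternative. *)
Lemma greedy_exists (b : R) : (forall x, T x -> 0 < rho x <= b) ->
  forall N, exists2 s, greedy s & size s = N \/ (forall z, T z -> covered s z).
Proof.
move=> bnd; elim=> [|N [s gs [sN|]]]; first by exists [::] => //; left.
  have [cov|ncov] := pselect (forall z, T z -> covered s z).
    by exists s => //; right.
  have [x [Tx nx] max] : exists2 x, (T `\` covered s) x &
      forall z, (T `\` covered s) z -> rho z < 2 * rho x.
    apply: (near_maximizer _ b) => [|x [/bnd]//].
    apply: contrapT => h; apply: ncov => z Tz; apply: contrapT => nz.
    by apply: h; exists z.
  exists (x :: s); last by left; rewrite /= sN.
  by split => // z Tz nz; apply: max.
by exists s => //; right.
Qed.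

End Greedy.

Section Cube.
Context {R : realType} {d : nat}.
Implicit Types (x y z : d.-tuple R) (r : R).

Definition cube x r : set (d.-tuple R) :=
  [set y | forall i, Defs.arc (tnth x i - r) (2 * r) (tnth y i)].

Lemma cubeP x r y : cube x r y <-> torus d y /\
  (forall i, exists k : int, `|tnth y i + k%:~R - tnth x i| <= r).
Proof.
split=> [h|[yT h] i].
  split => i; have [yi [k hk]] := h i => //.
  by exists k; rewrite ler_norml; lra.
split; first exact: yT.
by have [k hk] := h i; exists k; move: hk; rewrite ler_norml; lra.
Qed.

Lemma is_cube_cube x r : 0 < r <= 2^-1 -> is_cube (cube x r).
Proof.
move=> r0; exists [tuple tnth x i - r | i < d], (2 * r); split; first lra.
by apply/seteqP; split => y h i; have := h i; rewrite tnth_mktuple.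
Qed.

(* [delta y] is the displacement from [y] to [z] on the torus. Two centres whose
   displacements have the same signs and lie on the same side of the oldest
   radius are too close to each other. *)
Lemma cube_multiplicity (rho : d.-tuple R -> R) (s : seq (d.-tuple R)) z :
  pairwise (greedy_rel (fun x => cube x (rho x)) rho) s ->
  (forall x, x \in s -> torus d x /\ 0 < rho x) ->
  (forall x, x \in s -> cube x (rho x) z) ->
  (size s <= 4 ^ d)%N.
Proof.
move=> ps sT sz.
have [delta deltaP] : {delta : d.-tuple R * 'I_d -> R & forall p : d.-tuple R * 'I_d,
    cube p.1 (rho p.1) z -> `|delta p| <= rho p.1 /\
      exists k : int, tnth z p.2 + k%:~R = tnth p.1 p.2 + delta p}.
  apply: (@choice _ _ (fun (p : d.-tuple R * 'I_d) v => cube p.1 (rho p.1) z ->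
    `|v| <= rho p.1 /\ exists k : int, tnth z p.2 + k%:~R = tnth p.1 p.2 + v)).
  move=> -[y i] /=.
  have [/cubeP[_ /(_ i)[k yz]]|nyz] := pselect (cube y (rho y) z); last by exists 0.
  exists (tnth z i + k%:~R - tnth y i) => _; split => //; exists k.
  by rewrite addrCA subrr addr0.
(* Both displacements lead to the same point [z], so up to an integer their difference is the
   displacement between the two centres. *)
have close x y : x \in s -> y \in s ->
    (forall i, `|delta (x, i) - delta (y, i)| <= rho y) -> cube y (rho y) x.
  move=> xs ys h; apply/cubeP; split; first exact: (sT _ xs).1.
  move=> i; have [_ [k /= hk]] := deltaP (x, i) (sz _ xs).
  have [_ [l /= hl]] := deltaP (y, i) (sz _ ys).
  exists (l - k); rewrite intrD intrN -normrN.
  have -> : - (tnth x i + (l%:~R - k%:~R) - tnth y i) = delta (x, i) - delta (y, i).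
    lra.
  exact: h.
have dle y i : y \in s -> `|delta (y, i)| <= rho y.
  by move=> ys; have [] := deltaP (y, i) (sz _ ys).
pose sgn y := [ffun i : 'I_d => 0 <= delta (y, i)].
have one_sign sg : (count (fun y => sgn y == sg) s <= 2 ^ d)%N.
  rewrite -size_filter; set t := seq.filter _ _.
  have tP y : y \in t -> y \in s /\ sgn y = sg.
    by rewrite mem_filter => /andP[/eqP].
  have pt : pairwise (greedy_rel (fun x => cube x (rho x)) rho) t.
    exact: pairwise_filter.
  clearbody t; case: (lastP t) tP pt => [//|t' w] tP.
  rewrite pairwise_rcons => /andP[/allP tw pt'].
  have wt : w \in rcons t' w by rewrite mem_rcons mem_head.
  have [ws sgnw] := tP _ wt.
  have same_sign x y i : x \in rcons t' w -> y \in rcons t' w ->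
      (0 <= delta (x, i)) = (0 <= delta (y, i)).
    move=> /tP[_ sx] /tP[_ sy].
    have : sgn x i = sgn y i by rewrite sx sy.
    by rewrite /sgn !ffunE.
  (* [w] is the oldest centre of its class, which gives the upper bound. If [rho y] were below
     [rho w], both displacements would have size at most [rho w] and the same sign, placing [y] in
     the cube of [w]. *)
  have rho_bnd y : y \in rcons t' w -> rho w <= rho y < 2 * rho w.
    move=> yt; have [ys _] := tP _ yt.
    have [_ w0] := sT _ ws.
    move: (yt); rewrite mem_rcons inE => /orP[/eqP->|yt']; first lra.
    have /asboolP[nwy ->] := tw _ yt'; rewrite andbT leNgt; apply/negP => yw.
    apply: nwy; apply: close => // i.
    have := dle _ i ys; have := dle _ i ws; rewrite !ler_norml.
    by have := same_sign _ _ i yt wt; case: (leP 0 (delta (y, i)));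
      case: (leP 0 (delta (w, i))) => //; lra.
  (* Sizes of displacements lie in [0, 2 [rho w]). Cutting at [rho w] leaves two intervals of length
     [rho w], which is at most every radius of the class; equal codes would therefore put one centre
     in the cube of an older one. *)
  pose code y := [ffun i : 'I_d => `|delta (y, i)| < rho w].
  rewrite -(size_map code) -(_ : #|{ffun 'I_d -> bool}| = 2 ^ d)%N; last first.
    by rewrite card_ffun card_bool card_ord.
  apply: (@leq_trans #|map code (rcons t' w)|); last exact: max_card.
  rewrite (card_uniqP _)//.
  rewrite uniq_pairwise pairwise_map.
  have : pairwise (greedy_rel (fun x => cube x (rho x)) rho) (rcons t' w).
    by rewrite pairwise_rcons pt' andbT; apply/allP.
  apply: (@sub_in_pairwise _ [in rcons t' w]) => [x y xt yt /asboolP[nyx _]|]; last first.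
    exact/allP.
  apply/eqP => xy; apply: nyx.
  have [[xs _] [ys _]] := (tP _ xt, tP _ yt).
  apply: close => // i; have := same_sign _ _ i xt yt.
  have cxy : (`|delta (x, i)| < rho w) = (`|delta (y, i)| < rho w).
    have : code x i = code y i by rewrite xy.
    by rewrite /code !ffunE.
  have := rho_bnd _ xt; have := rho_bnd _ yt.
  have := dle _ i xs; have := dle _ i ys.
  move: cxy; case: (leP 0 (delta (x, i))); case: (leP 0 (delta (y, i))) => //.
  - move=> y0 x0; rewrite (ger0_norm x0) (ger0_norm y0) ler_norml.
    by case: (ltP (delta (y, i)) (rho w)); case: (ltP (delta (x, i)) (rho w)) => //; lra.
  - move=> y0 x0; rewrite (ltr0_norm x0) (ltr0_norm y0) ler_norml.
    by case: (ltP (- delta (y, i)) (rho w)); case: (ltP (- delta (x, i)) (rho w)) => //; lra.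
rewrite -sum1_size (partition_big sgn xpredT)//=.
rewrite (eq_bigr (fun sg => count (fun y => sgn y == sg) s)); last first.
  by move=> sg _; rewrite sum1_count.
rewrite (leq_trans (leq_sum _ (fun sg _ => one_sign sg)))//.
rewrite sum_nat_const card_ffun card_bool card_ord -expnMn.
by [].
Qed.
End Cube.

(** * Cubes and Haar measure *)

Section HaarTorus.
Context {R : realType} {d : nat} (m : {measure set (d.-tuple R) -> \bar R}).
Context (haar : haar_torus m).

Lemma measurable_coord (A : set R) (i : 'I_d) : measurable A ->
  measurable [set y : d.-tuple R | A (tnth y i)].
Proof. by move=> mA; have := measurable_tnth i measurableT mA; rewrite setTI. Qed.

Lemma measurable_forall_coord (A : 'I_d -> set R) : (forall i, measurable (A i)) ->
  measurable [set y : d.-tuple R | forall i, A i (tnth y i)].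
Proof.
move=> mA.
have -> : [set y : d.-tuple R | forall i, A i (tnth y i)] =
    \bigcap_(i in [set: 'I_d]) [set y : d.-tuple R | A i (tnth y i)].
  by apply/seteqP; split => y h i; [move=> _|]; exact: h.
apply: fin_bigcap_measurable; first exact: finite_finset.
by move=> i _; exact: measurable_coord.
Qed.

Lemma measurable_torus : measurable (torus d : set (d.-tuple R)).
Proof.
apply: (measurable_forall_coord (fun=> `[0, 1[%classic)) => i.
exact: measurable_itv.
Qed.

Lemma haar_torusT : m (torus d) = 1%E.
Proof.
have [_ /(_ [tuple 0 | _ < d] [tuple 1 | _ < d])] := haar.
rewrite big1 => [|i _]; last by rewrite !tnth_mktuple subr0.
move=> <-; last by move=> i; rewrite !tnth_mktuple lexx ler01.
by congr (m _); apply/seteqP; split => y h i; have := h i; rewrite !tnth_mktuple.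
Qed.

Lemma haar_torus_fin (A : set (d.-tuple R)) : measurable A -> A `<=` torus d ->
  m A \is a fin_num.
Proof.
move=> mA AT; rewrite ge0_fin_numE//; apply: (@le_lt_trans _ _ 1%E); last exact: ltry.
rewrite -haar_torusT; apply: le_measure; rewrite ?inE//; exact: measurable_torus.
Qed.

Lemma haar_slab (i : 'I_d) (a b : R) : 0 <= a -> a <= b -> b <= 1 ->
  m [set y | torus d y /\ a <= tnth y i < b] = (b - a)%:E.
Proof.
move=> a0 ab b1; have [_ H] := haar.
have := H [tuple (if j == i then a else 0) | j < d]
  [tuple (if j == i then b else 1) | j < d].
rewrite (bigD1 i)//= !tnth_mktuple eqxx big1 => [|j ji]; last first.
  by rewrite !tnth_mktuple (negbTE ji) subr0.
rewrite mulr1 => <-; last first.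
  by move=> j; rewrite !tnth_mktuple; case: eqP => _; lra.
congr (m _); apply/seteqP; split => y /=.
  by move=> [Ty hy] j; have := Ty j; rewrite !tnth_mktuple; case: eqP => [->|].
move=> h; split; last by have := h i; rewrite !tnth_mktuple eqxx.
by move=> j; have := h j; rewrite !tnth_mktuple; case: eqP => _; lra.
Qed.

(** It is empty or contained in slabs of arbitrarily small width. *)
Lemma haar_hyperplane (i : 'I_d) (c : R) :
  m.-negligible [set y | torus d y /\ tnth y i = c].
Proof.
have [c01|nc] := pselect (0 <= c < 1); last first.
  rewrite (_ : [set y | _] = set0); first exact: negligible_set0.
  by rewrite -subset0 => y [Ty yc]; apply: nc; rewrite -yc.
have mH : measurable [set y : d.-tuple R | torus d y /\ tnth y i = c].
  apply: measurableI; first exact: measurable_torus.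
  exact: (measurable_coord [set c]).
exists [set y : d.-tuple R | torus d y /\ tnth y i = c]; split => //.
apply/eqP; rewrite eq_le measure_ge0 andbT.
apply/lee_addgt0Pr => e e0; rewrite add0e.
(* [haar_torus] prescribes the measure of boxes inside the unit cube only, hence the cap at 1. *)
pose b := Num.min (c + e) 1.
have [cb be b1] : [/\ c <= b, b - c <= e & b <= 1].
  by rewrite /b; case: (leP (c + e) 1); split; lra.
apply: (@le_trans _ _ (b - c)%:E); last by rewrite lee_fin.
have bc : c < b by rewrite /b lt_min; lra.
rewrite -(haar_slab i); [|lra|lra|lra].
apply: le_measure; rewrite ?inE//; last first.
  by move=> y [Ty yc]; split => //; rewrite yc lexx bc.
apply: measurableI; first exact: measurable_torus.
exact: (measurable_coord `[c, b[%classic i (measurable_itv _)).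
Qed.

(* On the circle, the distance from [0] to a real [t] with [|t| < 1]. *)
Definition circle_norm (t : R) : R := Num.min `|t| (Num.min `|t + 1| `|t - 1|).

Lemma cube_circle_norm (x : d.-tuple R) (r : R) : torus d x ->
  cube x r = [set y | torus d y /\ forall i, circle_norm (tnth y i - tnth x i) <= r].
Proof.
move=> Tx; apply/seteqP; split => y.
  move=> /cubeP[Ty h]; split => // i; have [k] := h i.
  have := Ty i; have := Tx i; rewrite /circle_norm !ge_min.
  have [->|] := eqVneq k 0; first by rewrite addr0 => _ _ ->.
  have [->|] := eqVneq k 1.
    by rewrite (_ : _ - _ = tnth y i - tnth x i + 1) => [_ _ _ ->|]; [rewrite orbT|ring].
  have [->|] := eqVneq k (-1).
    rewrite (_ : _ - _ = tnth y i - tnth x i - 1) => [_ _ _ _ ->|]; first by rewrite !orbT.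
    by rewrite intrN; ring.
  (* Coordinates differ by less than 1, so a shift by at least 2 lands farther away than no shift at
     all. *)
  move=> k1 k2 k0 x01 y01 h'; apply/orP; left; apply: le_trans h'.
  have [k3|k3] : (2 <= k) \/ (k <= -2) by lia.
  - have : (2 : R) <= k%:~R by rewrite (_ : 2 = 2%:~R)// ler_int.
    rewrite ler_norml => hk; have := ler_norm (tnth y i + k%:~R - tnth x i); lra.
  - have : k%:~R <= (-2 : R) by rewrite (_ : -2 = (-2)%:~R)// ler_int.
    rewrite ler_norml => hk.
    have := ler_norm (- (tnth y i + k%:~R - tnth x i)); rewrite normrN; lra.
move=> [Ty h]; apply/cubeP; split => // i; have := h i.
rewrite /circle_norm !ge_min => /or3P[] h'.
- by exists 0; rewrite addr0.
- by exists 1; rewrite addrAC.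
- by exists (-1); rewrite intrN addrAC.
Qed.

Lemma measurable_cube (x : d.-tuple R) (r : R) : measurable (cube x r).
Proof.
apply: (measurable_forall_coord (fun i => Defs.arc (tnth x i - r) (2 * r))) => i.
have -> : Defs.arc (tnth x i - r) (2 * r) = `[0, 1[%classic `&`
    \bigcup_(k : int) `[tnth x i - r - k%:~R, tnth x i - r + 2 * r - k%:~R]%classic.
  apply/seteqP; split => y /=; rewrite in_itv/=.
    by move=> [y01 [k hk]]; split => //; exists k => //=; rewrite in_itv/=; lra.
  by move=> [y01 [k _ /=]]; rewrite in_itv/= => hk; split => //; exists k; lra.
apply: measurableI; first exact: measurable_itv.
by apply: countable_bigcupT_measurable => // k; exact: measurable_itv.
Qed.

Lemma cube_sub_torus (x : d.-tuple R) (r : R) : cube x r `<=` torus d.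
Proof. by move=> y /cubeP[]. Qed.

Lemma cube_gt0 (x : d.-tuple R) (r : R) : torus d x -> 0 < r -> (0 < m (cube x r))%E.
Proof.
move=> Tx r0; have [_ H] := haar.
(* The box extends from the centre to the right only and stops at 1, so it does not wrap around. *)
pose b := [tuple Num.min (tnth x i + r) 1 | i < d].
have bP i : tnth x i < tnth b i <= tnth x i + r /\ tnth b i <= 1.
  have := Tx i; rewrite /b tnth_mktuple.
  by case: (leP (tnth x i + r) 1); lra.
have box := H x b.
apply: (@lt_le_trans _ _ (m [set t | forall i, tnth x i <= tnth t i < tnth b i])).
  rewrite box => [|i]; last by have := bP i; have := Tx i; lra.
  by rewrite lte_fin prodr_gt0// => i _; have := bP i; lra.
apply: le_measure; rewrite ?inE//.
- apply: (measurable_forall_coord (fun i => `[tnth x i, tnth b i[%classic)) => i.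
  exact: measurable_itv.
- exact: measurable_cube.
- move=> y h; apply/cubeP; split => i.
    by have := h i; have := bP i; have := Tx i; lra.
  by exists 0; rewrite addr0 ler_norml; have := h i; have := bP i; lra.
Qed.

Lemma cube_half (x : d.-tuple R) : torus d x -> cube x 2^-1 = torus d.
Proof.
move=> Tx; rewrite cube_circle_norm//; apply/seteqP; split => y; first by case.
move=> Ty; split => // i; have := Ty i; have := Tx i.
rewrite /circle_norm !ge_min !ler_norml; lra.
Qed.

(** One of three absolute values equals [r], each with two signs: six hyperplanes. *)
Lemma circle_norm_sphere (x : d.-tuple R) (r : R) (i : 'I_d) :
  m.-negligible [set y | torus d y /\ circle_norm (tnth y i - tnth x i) = r].
Proof.
apply: (@negligibleS _ _ _ _ (\big[setU/set0]_(e <- [:: r; r + 1; r - 1; -r; -r + 1; - r - 1])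
   [set y | torus d y /\ tnth y i = tnth x i + e])); last first.
  rewrite !big_cons big_nil. do 6 (apply: negligibleU; first exact: haar_hyperplane).
  exact: negligible_set0.
move=> y [Ty h]; rewrite !big_cons big_nil.
have E e : tnth y i - tnth x i = e -> tnth y i = tnth x i + e by move=> <-; lra.
have : [\/ `|tnth y i - tnth x i| = r, `|tnth y i - tnth x i + 1| = r |
    `|tnth y i - tnth x i - 1| = r].
  move: h; rewrite /circle_norm /Order.min; case: ifP => _; first by constructor 1.
  by case: ifP => _; [constructor 2|constructor 3].
move=> [] /eqP; rewrite eqr_norml => /andP[/orP[] /eqP hh _].
- by left; split => //; apply: E.
- by do 3 right; left; split => //; apply: E.
- by do 2 right; left; split => //; apply: E; lra.
- by do 5 right; left; split => //; apply: E; lra.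
- by right; left; split => //; apply: E; lra.
- by do 4 right; left; split => //; apply: E; lra.
Qed.

(** Membership can change in the limit only where some coordinate is at distance exactly [r] from
    the centre, which is a null set. *)
Lemma ae_cube_cvg (x : d.-tuple R) (r : R) (u : nat -> R) : torus d x ->
  u @ \oo --> r ->
  {ae m, forall y, torus d y -> \forall n \near \oo, cube x (u n) y <-> cube x r y}.
Proof.
move=> Tx ur.
suff : {ae m, forall y, torus d y -> forall i, circle_norm (tnth y i - tnth x i) != r}.
  apply: filterS => y h Ty.
  have : \forall n \near \oo, forall i, (circle_norm (tnth y i - tnth x i) <= u n) =
      (circle_norm (tnth y i - tnth x i) <= r).
    apply: filter_forall => i; have := h Ty i.
    case: (ltgtP (circle_norm (tnth y i - tnth x i)) r) => // cr _.
      near=> n; apply: ltW; near: n; exact: (cvgr_gt _ ur).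
    near=> n; apply: lt_geF; near: n; exact: (cvgr_lt _ ur).
  apply: filterS => n hn; rewrite !cube_circle_norm//=.
  by split => -[_ hi]; split => // i; have := hi i; rewrite hn.
have : forall i, {ae m, forall y, torus d y -> circle_norm (tnth y i - tnth x i) != r}.
  move=> i; apply: negligibleS (circle_norm_sphere x r i).
  move=> y /= /not_implyP[Ty /negP]; rewrite negbK => /eqP yr; split => //.
move/filter_forall; apply: filterS => y h Ty i; exact: h.
Unshelve. all: by end_near. Qed.

End HaarTorus.

(** * Cubes with prescribed modular *)

Section CubeModular.
Context {R : realType} {d : nat} (m : {measure set (d.-tuple R) -> \bar R}).
Context (haar : haar_torus m) (x : d.-tuple R) (Tx : torus d x).

(** Dominated convergence, with the moving domain absorbed into the integrand. The integrand varies
    with [n] too, since the measure of the cube stands inside [M]. *)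
Lemma cube_integral_cvg (r : R) (u : nat -> R) (w_ : nat -> d.-tuple R -> \bar R)
    (w g : d.-tuple R -> \bar R) :
  u @ \oo --> r ->
  (forall n, measurable_fun (torus d) (w_ n)) -> measurable_fun (torus d) w ->
  (forall y, torus d y -> w_ ^~ y @ \oo --> w y) ->
  m.-integrable (torus d) g ->
  (forall n y, torus d y -> (`|w_ n y| <= g y)%E) ->
  (\int[m]_(y in cube x (u n)) w_ n y @[n --> \oo] --> \int[m]_(y in cube x r) w y)%E.
Proof.
move=> ur mw_ mw ww ig wg.
have restr s (f : d.-tuple R -> \bar R) :
    (\int[m]_(y in cube x s) f y = \int[m]_(y in torus d) (f \_ (cube x s)) y)%E.
  by rewrite -integral_mkcondr setIidr//; exact: cube_sub_torus.
rewrite restr; under eq_fun do rewrite restr.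
have mT := @measurable_torus R d.
have mC s : measurable (cube x s) by exact: measurable_cube.
have mres s (f : d.-tuple R -> \bar R) : measurable_fun (torus d) f ->
    measurable_fun (torus d) (f \_ (cube x s)).
  move=> mf; apply: (measurable_restrict _ (mC s) mT).1.
  by apply: (measurable_funS mT _ mf) => //; exact: subIsetl.
have [] // := @dominated_convergence _ _ R m (torus d) mT
  (fun n => w_ n \_ (cube x (u n))) (w \_ (cube x r)) g.
- by move=> n; exact: mres.
- exact: mres.
- have := ae_cube_cvg m haar x r u Tx ur; apply: filterS => y h Ty.
  have [Cy|nCy] := pselect (cube x r y).
    rewrite [X in _ --> X]patchE mem_set//; apply: cvg_trans (ww y Ty).
    apply: near_eq_cvg; apply: filterS (h Ty) => n hn.
    by rewrite patchE mem_set//; apply/hn.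
  rewrite [X in _ --> X]patchE memNset//; apply: cvg_trans (cvg_cst _).
  apply: near_eq_cvg; apply: filterS (h Ty) => n hn.
  by rewrite patchE memNset// => /hn.
- by apply: eventually_filter.
- apply: aeW => y n Ty; rewrite patchE; case: ifPn => _; first exact: wg.
  by rewrite abse0 (le_trans _ (wg n y Ty)).
Qed.

Lemma cube_measure_cvg (r : R) (u : nat -> R) : u @ \oo --> r ->
  fine (m (cube x (u n))) @[n --> \oo] --> fine (m (cube x r)).
Proof.
have mC s : measurable (cube x s) by exact: measurable_cube.
move=> ur; apply: fine_cvg; rewrite fineK; last first.
  exact: (haar_torus_fin m haar _ (mC r) (cube_sub_torus x r)).
have eq s : m (cube x s) = (\int[m]_(y in cube x s) (cst 1 y))%E.
  by rewrite integral_cst// mul1e.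
rewrite eq; under eq_fun do rewrite eq.
apply: (cube_integral_cvg _ _ _ _ (cst 1%E)) => //.
- by move=> y _; exact: cvg_cst.
- apply/integrableP; split => //.
  under eq_integral do rewrite abse1.
  rewrite integral_cst//; last exact: measurable_torus.
  by rewrite mul1e haar_torusT ?ltry.
- by move=> n y _; rewrite abse1.
Qed.

Context (M : R -> R) (oM : orlicz_fun M) (h : d.-tuple R -> R).
Context (mh : measurable_fun (torus d) h) (h0 : forall y, 0 <= h y).
Context (ih : (\int[m]_(y in torus d) (M (h y))%:E < +oo)%E).

Let v r := fine (m (cube x r)).
Let G r := (\int[m]_(y in cube x r) (M (v r * h y))%:E)%E.

Let mT := @measurable_torus R d.

Let mC r : measurable (cube x r).
Proof. exact: measurable_cube. Qed.

Let vE r : m (cube x r) = (v r)%:E.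
Proof.
by rewrite fineK//; exact: (haar_torus_fin m haar _ (mC r) (cube_sub_torus x r)).
Qed.

Let v01 r : 0 <= v r <= 1.
Proof.
rewrite fine_ge0//= -lee_fin -vE -(haar_torusT m haar).
by apply: le_measure; rewrite ?inE//; exact: cube_sub_torus.
Qed.

Let mMh c : measurable_fun (torus d) (fun y => (M (c * h y))%:E).
Proof. by apply: measurable_orlicz_comp => //; exact: measurable_funM. Qed.

Let Mh_le c y : 0 <= c <= 1 -> M (c * h y) <= M (h y).
Proof.
move=> /andP[c0 c1]; apply: orlicz_fun_nd => //; first by rewrite mulr_ge0.
by rewrite ler_piMl.
Qed.

Let iMh : m.-integrable (torus d) (fun y => (M (h y))%:E).
Proof.
apply/integrableP; split.
  by apply: measurable_orlicz_comp.
under eq_integral do rewrite gee0_abs ?lee_fin ?orlicz_fun_ge0//.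
exact: ih.
Qed.

Let G_fin r : G r \is a fin_num.
Proof.
rewrite ge0_fin_numE; last first.
  by apply: integral_ge0 => y _; rewrite lee_fin orlicz_fun_ge0.
apply: le_lt_trans ih.
apply: (@le_trans _ _ (\int[m]_(y in torus d) (M (v r * h y))%:E)%E).
  apply: ge0_subset_integral => //; last exact: cube_sub_torus.
  by move=> y _; rewrite lee_fin orlicz_fun_ge0.
apply: ge0_le_integral => //.
- by move=> y _; rewrite lee_fin orlicz_fun_ge0.
- by apply: measurable_orlicz_comp.
- by move=> y _; rewrite lee_fin Mh_le.
Qed.

(** The measure of a cube is at most 1, so [M (h y)] dominates all the integrands. *)
Let balance_continuous : continuous (fun r => fine (G r) - v r).
Proof.
move=> r; apply/(@cvg_nbhsP _ R^o) => u ur.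
apply: cvgB; last exact: cube_measure_cvg.
apply: fine_cvg; rewrite fineK//.
apply: (cube_integral_cvg _ _ (fun n y => (M (v (u n) * h y))%:E) _
  (fun y => (M (h y))%:E)) => //.
  move=> y Ty; apply: cvg_EFin; first exact: nearW.
  have cM := orlicz_fun_continuous M oM (v r * h y).
  apply: (@continuous_cvg _ _ _ _ _ (fun n => v (u n) * h y) M) => //.
  by apply: cvgM; [exact: cube_measure_cvg|exact: cvg_cst].
by move=> n y _; rewrite gee0_abs lee_fin ?orlicz_fun_ge0 ?Mh_le.
Qed.

Lemma exists_balanced_cube (i0 : 'I_d) :
  (1 <= \int[m]_(y in torus d) (M (h y))%:E)%E ->
  exists2 r, 0 < r <= 2^-1 &
    (\int[m]_(y in cube x r) (M (fine (m (cube x r)) * h y))%:E = m (cube x r))%E.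
Proof.
move=> ge1.
(* Radius 0 balances trivially, so the intermediate value theorem has to start from a positive
   radius. By convexity [G r] is at most [v r] times the integral of [M h] over the cube, and that
   integral tends to 0. *)
have [r0 r0P r0G] : exists2 r0, 0 < r0 <= 2^-1 & fine (G r0) - v r0 <= 0.
  pose u n : R := 2^-1 * n.+1%:R^-1.
  have u0 : u @ \oo --> (0 : R).
    by rewrite -(mulr0 (2^-1 : R)); apply: cvgM; [exact: cvg_cst|exact: cvg_harmonic].
  have : (\int[m]_(y in cube x (u n)) (M (h y))%:E @[n --> \oo] -->
          \int[m]_(y in cube x 0) (M (h y))%:E)%E.
    apply: (cube_integral_cvg _ _ (fun=> fun y => (M (h y))%:E) _ (fun y => (M (h y))%:E)) => //.
    - by move=> _; apply: measurable_orlicz_comp.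
    - by apply: measurable_orlicz_comp.
    - by move=> y _; exact: cvg_cst.
    - by move=> n y _; rewrite gee0_abs lee_fin ?orlicz_fun_ge0.
  have -> : (\int[m]_(y in cube x 0) (M (h y))%:E = 0)%E.
    (* A cube of radius 0 lies in a hyperplane once there is a coordinate [i0]. *)
    have N0 : m (cube x 0) = 0%E.
      apply/(measure_negligible (mC 0)).
      apply: negligibleS (circle_norm_sphere m haar x 0 i0) => y.
      rewrite cube_circle_norm// => -[Ty /(_ i0) hy]; split => //.
      by apply/eqP; rewrite eq_le hy /circle_norm !le_min !normr_ge0.
    apply: null_set_integral => //.
    apply: (measurable_funS mT (cube_sub_torus x 0)).
    by apply: measurable_orlicz_comp.
  move=> cv; have [n _ /(_ n (leqnn _)) hn] : \forall n \near \oo,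
      (\int[m]_(y in cube x (u n)) (M (h y))%:E < 1)%E.
    by apply: (cv _ (open_ereal_lt' _)); rewrite lte_fin.
  exists (u n).
    rewrite mulr_gt0 ?invr_gt0//= ger_pMr ?invr_gt0// invf_le1//.
    by rewrite ler1n.
  rewrite subr_le0 -lee_fin fineK//.
  apply: (@le_trans _ _ (\int[m]_(y in cube x (u n)) ((v (u n))%:E * (M (h y))%:E))%E).
    have Csub := cube_sub_torus x (u n).
    apply: ge0_le_integral => //.
    - by move=> y _; rewrite lee_fin orlicz_fun_ge0.
    - exact: (measurable_funS mT Csub).
    - apply: measurable_funeM; apply: (measurable_funS mT Csub).
      by apply: measurable_orlicz_comp.
    - by move=> y _; rewrite -EFinM lee_fin orlicz_funZ_le.
  rewrite ge0_integralZl//; last 3 first.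
  - apply: (measurable_funS mT (cube_sub_torus x (u n))).
    by apply: measurable_orlicz_comp.
  - by move=> y _; rewrite lee_fin orlicz_fun_ge0.
  - by rewrite lee_fin; case/andP: (v01 (u n)).
  rewrite -[leRHS]mule1 lee_wpmul2l ?(ltW hn)//.
  by rewrite lee_fin; case/andP: (v01 (u n)).
have half : 0 <= fine (G 2^-1) - v 2^-1.
  have vh : v 2^-1 = 1 by rewrite /v cube_half// haar_torusT.
  rewrite vh subr_ge0 -lee_fin fineK// /G vh cube_half//.
  by under eq_integral do rewrite mul1r.
have /andP[_ r0h] := r0P.
have [||r] := @IVT R (fun r => fine (G r) - v r) r0 2^-1 0 r0h.
- exact/continuous_subspaceT/balance_continuous.
- by rewrite ge_min r0G le_max half orbT.
rewrite in_itv/= => rP /eqP; rewrite subr_eq0 => /eqP Gv.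
exists r; first by have := r0P; lra.
by rewrite -/(v r) -/(G r) -(fineK (G_fin r)) Gv vE.
Qed.

End CubeModular.

(** * The functional J *)

Section JfM.
Context {R : realType} {d} {T : measurableType d} (m : {measure set T -> \bar R}).
Context (A : set T) (M : R -> R) (f : T -> R).
Context (mA : measurable A) (finA : (m A < +oo)%E) (A0 : (0 < m A)%E).
Context (oM : orlicz_fun M) (mf : measurable_fun A f).

Let v := fine (m A).

Let v0 : 0 < v.
Proof. by rewrite fine_gt0// A0. Qed.

Let g := dilation v^-1 (drearr m A f).

Let measurable_modular (l : R) : measurable_fun setT (fun r : R => (M (r / l))%:E).
Proof. by apply: measurable_orlicz_comp => //; exact: measurable_funM. Qed.

Let modular (l : R) : (\int[m]_(x in A) (M (`|f x| / l))%:E =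
  v%:E * \int[lebesgue_measure]_(t in @unit_open R) (M (`|g t| / l))%:E)%E.
Proof.
apply: (drearr_equimeasurable m A f mA mf finA (fun r : R => (M (r / l))%:E)) => //.
- by move=> r; rewrite lee_fin orlicz_fun_ge0.
- by rewrite mul0r orlicz_fun0.
Qed.

(** The hypothesis says that the dilated rearrangement has modular exactly 1 at [N / v]. At a
    smaller parameter the modular exceeds 1 by convexity, so [N / v] is the norm, and the factor
    m(A) in J cancels [v]. *)
Lemma JfM_eq (N : R) : 0 < N ->
  (\int[m]_(x in A) (M (v * (`|f x| / N)))%:E = m A)%E -> JfM m M f A = N%:E.
Proof.
move=> N0; have mAE : m A = v%:E by rewrite fineK// ge0_fin_numE.
have l0 : 0 < N / v by rewrite divr_gt0.
under eq_integral => x _.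
  rewrite (_ : v * (`|f x| / N) = `|f x| / (N / v)); last by field; rewrite !gt_eqF.
  over.
move=> eqA; rewrite /JfM -/v -/g.
suff -> : orlicz_norm lebesgue_measure (@unit_open R) M g = (N / v)%:E.
  by rewrite -EFinM mulrC divfK// gt_eqF.
apply/eqP; rewrite eq_le; apply/andP; split.
  apply: orlicz_norm_le => //.
  rewrite -(@lee_pmul2l _ v%:E) ?lte_fin//.
  by rewrite -modular eqA mAE mule1.
apply: le_ereal_inf_tmp => _ [l [lgt0 hl] <-]; rewrite lee_fin leNgt.
apply/negP => lN.
pose t := (N / v) / l.
have t1 : 1 < t by rewrite ltr_pdivlMr// mul1r.
have t0 : 0 < t by rewrite (lt_trans _ t1).
have : (t%:E * m A <= \int[m]_(x in A) (M (`|f x| / l))%:E)%E.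
  rewrite -eqA -ge0_integralZl//; last 3 first.
  - exact: measurable_orlicz_modular.
  - by move=> x _; rewrite lee_fin orlicz_fun_ge0.
  - by rewrite lee_fin ltW.
  apply: ge0_le_integral => //.
  - by move=> x _; apply: mule_ge0; rewrite lee_fin; [exact: ltW|exact: orlicz_fun_ge0].
  - by apply: measurable_funeM; exact: measurable_orlicz_modular.
  - exact: measurable_orlicz_modular.
  - move=> x _; rewrite -EFinM lee_fin.
    have -> : `|f x| / l = t * (`|f x| / (N / v)).
      by rewrite /t; field; rewrite !gt_eqF.
    by apply: orlicz_funZ_ge => //; exact: ltW.
rewrite modular mAE => h; have := le_trans h (lee_wpmul2l _ hl).
rewrite mule1 lee_fin ltW// => /(_ isT).
by rewrite -EFinM lee_fin ger_pMl// leNgt t1.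
Qed.

Lemma JfM_full : m A = 1%E -> JfM m M f A = orlicz_norm m A M f.
Proof.
move=> A1; have v1 : v = 1 by rewrite /v A1.
rewrite /JfM -/v -/g v1 mul1e; congr ereal_inf; congr (image _ _).
apply/seteqP; split => l /= [l0 hl]; split => //.
  by rewrite modular v1 mul1e.
by move: hl; rewrite modular v1 mul1e.
Qed.

(** Separability concerns functions on (0, 1), so the claim is transferred to the rearrangement of
    [f]. *)
Lemma full_modular_finite (K : R) : m A = 1%E -> orlicz01_separable M ->
  (orlicz_norm m A M f < +oo)%E -> 0 < K ->
  (\int[m]_(x in A) (M (K * `|f x|))%:E < +oo)%E.
Proof.
move=> A1 [F [F_space F_dense]] f_norm K0.
have v1 : v = 1 by rewrite /v A1.
rewrite (drearr_equimeasurable m A f mA mf finA (fun r : R => (M (K * r))%:E))//; last 3 first.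
- by apply: measurable_orlicz_comp => //; exact: measurable_funM.
- by move=> r; rewrite lee_fin orlicz_fun_ge0.
- by rewrite mulr0 orlicz_fun0.
rewrite -/v -/g v1 mul1e.
have lebU : (lebesgue_measure (@unit_open R) <= 1)%E.
  by rewrite /unit_open lebesgue_measure_itv/= lte_fin ltr01 sube0.
apply: (@separable_modular_finite R _ _ lebesgue_measure (@unit_open R) M F g K oM) => //.
- exact: measurable_itv.
- by move=> k; case: (F_space k).
- split; first exact: measurable_dilation_drearr.
  have /orlicz_norm_lt[l [l0 _ hl]] := f_norm.
  apply: (@le_lt_trans _ _ l%:E); last exact: ltry.
  by apply: orlicz_norm_le => //; move: hl; rewrite modular v1 mul1e.
Qed.

End JfM.

(** * Counting estimates and the covering theorem *)

Lemma sum_integral_multiplicity (R : realType) d (T : measurableType d)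
    (m : {measure set T -> \bar R}) (I : eqType) (s : seq I) (C : I -> set T)
    (D : set T) (W : T -> \bar R) (K : nat) :
  measurable D -> (forall i, measurable (C i)) -> (forall i, C i `<=` D) ->
  measurable_fun D W -> (forall y, (0 <= W y)%E) ->
  (forall y, D y -> (count (fun i => `[< C i y >]) s <= K)%N) ->
  (\sum_(i <- s) \int[m]_(y in C i) W y <= K%:R%:E * \int[m]_(y in D) W y)%E.
Proof.
move=> mD mC CD mW W0 cK.
have mWC i : measurable_fun D (W \_ (C i)).
  apply: (measurable_restrict _ (mC i) mD).1.
  by apply: (measurable_funS mD _ mW) => //; exact: subIsetl.
have WC0 i y : (0 <= (W \_ (C i)) y)%E by rewrite patchE; case: ifP.
under eq_bigr => i _ do rewrite -(setIidr (CD i)) integral_mkcondr.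
rewrite -ge0_integral_sum// -ge0_integralZl ?lee_fin//.
apply: ge0_le_integral => //.
- by move=> y _; apply: sume_ge0.
- by apply: emeasurable_sum.
- exact: measurable_funeM.
- move=> y Dy.
  have -> : (\sum_(i <- s) (W \_ (C i)) y)%E =
      ((count (fun i => `[< C i y >]) s)%:R%:E * W y)%E.
    elim: s {cK} => [|i s IH]; first by rewrite big_nil mul0e.
    rewrite big_cons IH /= natrD EFinD ge0_muleDl ?lee_fin// patchE.
    congr (_ + _)%E; have [Cy|nCy] := pselect (C i y).
      by rewrite mem_set// asboolT// mul1e.
    by rewrite memNset// asboolF// mul0e.
  by rewrite lee_wpmul2r// lee_fin ler_nat cK.
Qed.

(* If the modular at [N <= norm] were below 1, convexity between [1 / N] and
   [2 / N] would leave room for a parameter below the norm. *)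
Lemma modular_ge1 (R : realType) d (T : measurableType d)
    (m : {measure set T -> \bar R}) (D : set T) (M : R -> R) (f : T -> R) (N : R) :
  measurable D -> orlicz_fun M -> measurable_fun D f -> 0 < N ->
  (N%:E <= orlicz_norm m D M f)%E ->
  (\int[m]_(x in D) (M (2 * (`|f x| / N)))%:E < +oo)%E ->
  (1 <= \int[m]_(x in D) (M (`|f x| / N))%:E)%E.
Proof.
move=> mD oM mf N0 normN fin2; rewrite leNgt; apply/negP => lt1.
have mq (c : R) : measurable_fun D (fun x => (M (c * (`|f x| / N)))%:E).
  apply: measurable_orlicz_comp => //; apply: measurable_funM => //.
  apply: measurable_funM => //.
  exact: (measurableT_comp (@normr_measurable R setT) mf).
have mq1 : measurable_fun D (fun x => (M (`|f x| / N))%:E).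
  exact: measurable_orlicz_modular.
have i1 : (0 <= \int[m]_(x in D) (M (`|f x| / N))%:E)%E.
  by apply: integral_ge0 => x _; rewrite lee_fin orlicz_fun_ge0.
have i2 : (0 <= \int[m]_(x in D) (M (2 * (`|f x| / N)))%:E)%E.
  by apply: integral_ge0 => x _; rewrite lee_fin orlicz_fun_ge0.
have f1 : (\int[m]_(x in D) (M (`|f x| / N))%:E)%E \is a fin_num.
  by rewrite ge0_fin_numE// (lt_trans lt1)// ltry.
have f2 : (\int[m]_(x in D) (M (2 * (`|f x| / N)))%:E)%E \is a fin_num.
  by rewrite ge0_fin_numE.
set a := fine (\int[m]_(x in D) (M (`|f x| / N))%:E)%E.
set b := fine (\int[m]_(x in D) (M (2 * (`|f x| / N)))%:E)%E.
have a1 : 0 <= a < 1 by rewrite fine_ge0//= -lte_fin fineK.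
have b0 : 0 <= b by rewrite fine_ge0.
(* Weights [1 - e] and [e] on [1 / N] and [2 / N] give the parameter [N / (1 + e)], with modular at
   most [a + e * b <= 1]. The cap makes [e] a convex weight. *)
pose e := Num.min 1 ((1 - a) / (b + 1)).
have e0 : 0 < e by rewrite lt_min ltr01 divr_gt0//; lra.
have e1 : e <= 1 by rewrite ge_min lexx.
have eb : e * (b + 1) <= 1 - a by rewrite -ler_pdivlMr; [rewrite ge_min lexx orbT|lra].
pose l := N / (1 + e).
have l0 : 0 < l by rewrite divr_gt0//; lra.
have lN : l < N by rewrite /l ltr_pdivrMr ?ltr_pMr//; lra.
suff : (orlicz_norm m D M f <= l%:E)%E.
  by move=> /(le_trans normN); rewrite lee_fin leNgt lN.
apply: orlicz_norm_le => //.
apply: (@le_trans _ _ (\int[m]_(x in D)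
    ((1 - e)%:E * (M (`|f x| / N))%:E + e%:E * (M (2 * (`|f x| / N)))%:E))%E).
  apply: ge0_le_integral => //.
  - by move=> x _; rewrite lee_fin orlicz_fun_ge0.
  - exact: measurable_orlicz_modular.
  - by apply: emeasurable_funD; exact: measurable_funeM.
  - move=> x _; rewrite -!EFinM -EFinD lee_fin.
    have -> : `|f x| / l = (1 - e) * (`|f x| / N) + (1 - (1 - e)) * (2 * (`|f x| / N)).
      by rewrite /l; field; rewrite !gt_eqF//; lra.
    have -> : e * M (2 * (`|f x| / N)) = (1 - (1 - e)) * M (2 * (`|f x| / N)).
      by congr (_ * _); ring.
    by case: oM => _ cvx _; apply: cvx; lra.
rewrite ge0_integralD//; last 4 first.
- by move=> x _; apply: mule_ge0; rewrite lee_fin; [lra|exact: orlicz_fun_ge0].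
- exact: measurable_funeM.
- by move=> x _; apply: mule_ge0; rewrite lee_fin; [lra|exact: orlicz_fun_ge0].
- exact: measurable_funeM.
rewrite !ge0_integralZl//; try by [move=> x _; rewrite lee_fin orlicz_fun_ge0|rewrite lee_fin; lra].
by rewrite -(fineK f1) -(fineK f2) -/a -/b -!EFinM -EFinD lee_fin; nra.
Qed.

(** If [A] has measure at least [1 / (2 n)], the constant 1 suffices. Otherwise [|f| / (2 l)] is the
    balanced argument times [t = 1 / (2 n m(A)) >= 1], and convexity yields [t * m(A)]. *)
Lemma cube_integral_ge (R : realType) d (T : measurableType d)
    (m : {measure set T -> \bar R}) (A : set T) (M : R -> R) (f : T -> R)
    (l : R) (n : nat) :
  measurable A -> m A \is a fin_num -> (0 < m A)%E -> orlicz_fun M ->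
  measurable_fun A f -> 0 < l -> (0 < n)%N ->
  (\int[m]_(y in A) (M (fine (m A) * (`|f y| / (l / n%:R))))%:E = m A)%E ->
  ((2 * n%:R)^-1%:E <= \int[m]_(y in A) (1 + (M (`|f y| / (2 * l)))%:E))%E.
Proof.
move=> mA finA A0 oM mf l0 n0 eqA; set v := fine (m A).
have nR : 0 < n%:R :> R by rewrite ltr0n.
have v0 : 0 < v by rewrite fine_gt0// A0/= ltey_eq finA.
have mAE : m A = v%:E by rewrite fineK.
have mM (c : R) : measurable_fun A (fun y => (M (`|f y| / c))%:E).
  exact: measurable_orlicz_modular.
rewrite ge0_integralD//; last by move=> y _; rewrite lee_fin orlicz_fun_ge0.
rewrite integral_cst// mul1e mAE.
have i0 : (0 <= \int[m]_(y in A) (M (`|f y| / (2 * l)))%:E)%E.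
  by apply: integral_ge0 => y _; rewrite lee_fin orlicz_fun_ge0.
have [nv|vn] := leP (2 * n%:R)^-1 v.
  by rewrite (@le_trans _ _ v%:E) ?lee_fin// leeDl.
apply: (@le_trans _ _ (\int[m]_(y in A) (M (`|f y| / (2 * l)))%:E)%E); last first.
  by rewrite leeDr// lee_fin ltW.
pose t := (2 * n%:R)^-1 / v.
have t1 : 1 <= t by rewrite ler_pdivlMr// mul1r ltW.
have -> : (2 * n%:R)^-1%:E = (t%:E * m A)%E.
  by rewrite mAE -EFinM /t divfK// gt_eqF.
have mv : measurable_fun A (fun y => (M (v * (`|f y| / (l / n%:R))))%:E).
  apply: measurable_orlicz_comp => //; apply: measurable_funM => //.
  apply: measurable_funM => //.
  exact: (measurableT_comp (@normr_measurable R setT) mf).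
have t0 : 0 <= t by lra.
rewrite -eqA -ge0_integralZl//; last by move=> y _; rewrite lee_fin orlicz_fun_ge0.
apply: ge0_le_integral => //.
- move=> y _; apply: mule_ge0; rewrite lee_fin//; exact: orlicz_fun_ge0.
- exact: measurable_funeM.
- move=> y _; rewrite -EFinM lee_fin.
  have -> : `|f y| / (2 * l) = t * (v * (`|f y| / (l / n%:R))).
    by rewrite /t; field; rewrite !gt_eqF.
  exact: orlicz_funZ_ge.
Qed.

Lemma card_ord_count (X : Type) (x0 : X) (s : seq X) (p : pred X) :
  #|[pred i : 'I_(size s) | p (nth x0 s i)]| = count p s.
Proof. by rewrite -sum1_count (big_nth x0) big_mkord sum1_card. Qed.

Theorem theorem3p1 (R : realType) (d : nat) : (0 < d)%N ->
  exists c : nat,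
  forall (m : {measure set (d.-tuple R) -> \bar R}), haar_torus m ->
  forall M : R -> R, orlicz_fun M -> orlicz01_separable M ->
  forall f : d.-tuple R -> R, orlicz_space m (torus d) M f ->
  forall n : nat, (0 < n)%N ->
  exists (k : nat) (P : 'I_k -> set (d.-tuple R)),
    [/\ (k <= c * n)%N,
        (forall i, is_cube (P i)),
        (forall x, torus d x -> exists i, P i x),
        (forall x, torus d x -> (#|[pred i : 'I_k | `[< P i x >]]| <= c)%N)
      & (forall i, JfM m M f (P i) =
                   ((n%:R)^-1%:E * orlicz_norm m (torus d) M f)%E)].
Proof.
move=> d0; exists (4 * 4 ^ d)%N => m haar M oM sepM f [mf f_norm] n n0.
have mT := @measurable_torus R d; have mT1 := haar_torusT m haar.
have nR : 0 < n%:R :> R by rewrite ltr0n.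
have T_fin : (m (torus d) < +oo)%E by rewrite mT1 ltry.
have T_gt0 : (0 < m (torus d))%E by rewrite mT1 lte_fin.
pose x0 : d.-tuple R := [tuple 0 | _ < d].
have Tx0 : torus d x0 by move=> i; rewrite tnth_mktuple lexx ltr01.
have norm_ge0 := orlicz_norm_ge0 M m (torus d) f.
have norm_fin : orlicz_norm m (torus d) M f \is a fin_num by rewrite ge0_fin_numE.
pose l := fine (orlicz_norm m (torus d) M f).
have normE : orlicz_norm m (torus d) M f = l%:E by rewrite fineK.
have l_ge0 : 0 <= l by rewrite -lee_fin -normE.
(* With norm zero there is no positive [N] to balance; the whole torus, as a cube of radius 1/2, has
   J equal to the norm. *)
have [l0|l_neq0] := eqVneq l 0.
  exists 1%N, (fun=> cube x0 2^-1); split.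
  - by rewrite muln_gt0 n0 muln_gt0 expn_gt0.
  - by move=> _; apply: is_cube_cube; rewrite lexx invr_gt0 ltr0n.
  - by move=> x Tx; exists ord0; rewrite cube_half.
  - move=> x _; apply: (leq_trans (max_card _)).
    by rewrite card_ord muln_gt0 expn_gt0.
  - by move=> _; rewrite cube_half// JfM_full// normE l0 mule0.
have l_gt0 : 0 < l by rewrite lt_neqAle eq_sym l_neq0.
pose N := l / n%:R; have N0 : 0 < N by rewrite divr_gt0.
(* Applied with [K = 1 / N] for the majorant and [K = 2 / N] for [modular_ge1]. *)
have modular_fin (K : R) : 0 < K -> (\int[m]_(y in torus d) (M (K * `|f y|))%:E < +oo)%E.
  by move=> K0; apply: full_modular_finite.
pose h y := `|f y| / N.
have h0 y : 0 <= h y by rewrite divr_ge0// ltW.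
have mh : measurable_fun (torus d) h.
  apply: measurable_funM => //.
  exact: (measurableT_comp (@normr_measurable R setT) mf).
have ih : (\int[m]_(y in torus d) (M (h y))%:E < +oo)%E.
  under eq_integral do rewrite /h mulrC.
  by apply: modular_fin; rewrite invr_gt0.
have ge1 : (1 <= \int[m]_(y in torus d) (M (h y))%:E)%E.
  apply: modular_ge1 => //.
    by rewrite normE lee_fin ler_pdivrMr// ler_peMr// ler1n.
  under eq_integral do rewrite mulrCA mulrC.
  by apply: modular_fin; rewrite mulr_gt0// invr_gt0.
have [rho rhoP] : {rho : d.-tuple R -> R & forall x, torus d x ->
    0 < rho x <= 2^-1 /\
    (\int[m]_(y in cube x (rho x)) (M (fine (m (cube x (rho x))) * h y))%:E =
     m (cube x (rho x)))%E}.
  apply: (@choice _ _ (fun (x : d.-tuple R) r => torus d x -> 0 < r <= 2^-1 /\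
    (\int[m]_(y in cube x r) (M (fine (m (cube x r)) * h y))%:E = m (cube x r))%E)).
  move=> x; have [Tx|nTx] := pselect (torus d x); last by exists 0.
  have [r r0 hr] := exists_balanced_cube m haar x Tx M oM h mh h0 ih (Ordinal d0) ge1.
  by exists r.
pose Q x := cube x (rho x).
have QT x : Q x `<=` torus d by exact: cube_sub_torus.
have mQ x : measurable (Q x) by exact: measurable_cube.
have Qfin x : m (Q x) \is a fin_num by exact: haar_torus_fin.
have mfQ x : measurable_fun (Q x) f by exact: (measurable_funS mT (QT x)).
(* The cubes through [z] form a sublist, which need not be greedy but keeps the pairwise
   relation. *)
have mult s z : greedy (torus d) Q rho s ->
    (count (fun x => `[< Q x z >]) s <= 4 ^ d)%N.
  move=> gs; rewrite -size_filter.
  apply: (cube_multiplicity rho _ z).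
  - exact/pairwise_filter/greedy_pairwise/gs.
  - move=> x; rewrite mem_filter => /andP[_ /(greedy_sub _ _ _ _ gs) Tx].
    by split => //; have [/andP[]] := rhoP _ Tx.
  - by move=> x; rewrite mem_filter => /andP[/asboolP].
have sizeP s : greedy (torus d) Q rho s -> (size s <= 4 * 4 ^ d * n)%N.
  move=> gs; pose W y := (1 + (M (`|f y| / (2 * l)))%:E)%E.
  have mM : measurable_fun (torus d) (fun y => (M (`|f y| / (2 * l)))%:E).
    exact: measurable_orlicz_modular.
  have W_le2 : (\int[m]_(y in torus d) W y <= 2%:E)%E.
    rewrite ge0_integralD//; last by move=> y _; rewrite lee_fin orlicz_fun_ge0.
    rewrite integral_cst// mul1e mT1.
    (* Since [2 * l] exceeds the norm, some admissible parameter lies below it. *)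
    have /orlicz_norm_lt[l' [l'0 l'l hl']] : (orlicz_norm m (torus d) M f < (2 * l)%:E)%E.
      by rewrite normE lte_fin; lra.
    have -> : 2%:E = (1 + 1)%E :> \bar R by rewrite -EFinD.
    rewrite leeD2l//; apply: le_trans hl'; apply: ge0_le_integral => //.
    - by move=> y _; rewrite lee_fin orlicz_fun_ge0.
    - exact: measurable_orlicz_modular.
    - move=> y _; rewrite lee_fin orlicz_fun_nd//.
        by rewrite divr_ge0// mulr_ge0// ltW.
      rewrite ler_wpM2l// lef_pV2 ?posrE//; last by rewrite mulr_gt0.
      by rewrite -lee_fin ltW.
  have W0 y : (0 <= W y)%E by rewrite adde_ge0// lee_fin orlicz_fun_ge0.
  have mW : measurable_fun (torus d) W by exact: emeasurable_funD.
  pose c : R := (2 * n%:R)^-1.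
  have lower : (((size s)%:R * c)%:E <= \sum_(x <- s) \int[m]_(y in Q x) W y)%E.
    have -> : ((size s)%:R * c)%:E = (\sum_(x <- s) c%:E)%E.
      by rewrite sumEFin big_const_seq count_predT iter_addr_0 mulr_natl.
    rewrite big_seq [leRHS]big_seq; apply: lee_sum => x xs.
    have Tx := greedy_sub _ _ _ _ gs _ xs; have [/andP[r0 _] eqx] := rhoP _ Tx.
    by apply: cube_integral_ge => //; exact: cube_gt0.
  have upper := @sum_integral_multiplicity R _ _ m _ s Q (torus d) W (4 ^ d) mT mQ QT
    mW W0 (fun y _ => mult s y gs).
  have : (((size s)%:R * c)%:E <= ((4 ^ d)%:R * 2)%:E)%E.
    apply: (le_trans lower); apply: (le_trans upper).
    by rewrite EFinM lee_wpmul2l// lee_fin.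
  rewrite lee_fin ler_pdivrMr ?mulr_gt0// -(ler_nat R) !natrM => hs.
  by apply: (le_trans hs); rewrite le_eqVlt; apply/orP; left; apply/eqP; ring.
have [s gs cov] : exists2 s, greedy (torus d) Q rho s &
    forall z, torus d z -> covered Q s z.
  (* One step more than [sizeP] allows, so the selection must have covered the torus. *)
  have [s gs [sN|cov]] := greedy_exists (torus d) Q rho 2^-1
    (fun x Tx => (rhoP x Tx).1) (4 * 4 ^ d * n).+1; last by exists s.
  by have := sizeP s gs; rewrite sN ltnn.
have sT := greedy_sub _ _ _ _ gs.
have nthT (i : 'I_(size s)) : torus d (nth x0 s i) by apply: sT; exact: mem_nth.
exists (size s), (fun i => Q (nth x0 s i)); split.
- exact: sizeP.
- by move=> i; apply: is_cube_cube; have [] := rhoP _ (nthT i).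
- move=> x /cov[y ys Qy].
  have ys' : (index y s < size s)%N by rewrite index_mem.
  by exists (Ordinal ys'); rewrite /= nth_index.
- move=> x _; rewrite (card_ord_count _ x0 s (fun y => `[< Q y x >])).
  by apply: leq_trans (mult s x gs) _; rewrite leq_pmull.
- move=> i; have Ti := nthT i; have [/andP[r0 _] eqi] := rhoP _ Ti.
  rewrite normE -EFinM mulrC -/N; apply: JfM_eq => //.
  + by rewrite ltey_eq Qfin.
  + exact: cube_gt0.
Qed.
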